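(* Let $G$ be a finite group and $(V,G)$ a permutation representation. Let $f\in\mathcal C^\infty_G$ be a germ at $0\in V$ of a smooth $G$-invariant function with $f(0)=0$, $df(0)=0$. If $f$ is $\mho$-regular (in the $G$-equivariant sense), then the germ of $\mho(f)$ at $0$ is finitely determined; that is, there is $r\in\mathbb N$ such that $T_0^rf$ is $\mho$-regular (in the $G$-equivariant sense).
   Context: A permutation representation is a finite-dimensional real vector space $V\cong\mathbb R^d$ on which $G$ acts by permuting the elements of a basis, which is taken orthonormal. $T_0^rf$ is the degree-$r$ Taylor polynomial of $f$ at $0$. Tangency set: $\mho(f)=\{x : D_if(x)\,x_j=D_jf(x)\,x_i \text{ for all } i,j\in[d]\}$. Canonical stratification: a stratification of a subset $X$ of a manifold is a locally finite partition of $X$ into submanifolds (strata). To a Whitney (b)-regular stratification associate $X_i$ = union of strata of dimension $\le i$; put $\mathfrak X<\mathfrak X'$ if for some $i$, $X_i\subsetneq X_i'$ and $X_j=X_j'$ for all $j>i$. Every closed semialgebraic set has a unique minimal Whitney regular stratification, called canonical. A map is transverse to a stratified set if it is transverse to each stratum. Equivariant regularity: let $p_1,\dots,p_l$ be a minimal set of homogeneous generators of the algebra of invariant polynomials $P(V)^G$, and $P=(p_1,\dots,p_l):V\to\mathbb R^l$ the orbit map. Let $P(V)^G_0$ be the $P(V)^G$-module of invariant polynomials vanishing together with their first derivatives at $0$, and $F_1,\dots,F_k$ a minimal set of homogeneous generators of it. By theorems of Schwarz and Malgrange every $f\in\mathcal C^\infty_G$ can be written $f=\sum_{i=1}^k(h_i\circ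 P)F_i$ with $H=(h_1,\dots,h_k):\mathbb R^l\to\mathbb R^k$ smooth. Put $H^1(y)=(H(y),DH(y))\in P^1(\mathbb R^l,\mathbb R^k)$, the space of polynomial maps $\mathbb R^l\to\mathbb R^k$ of degree at most one, identified with $\mathbb R^k\times L(\mathbb R^l,\mathbb R^k)$. Then $j^1f=u\circ(I,H^1\circ P)$, where $u:V\times P^1(\mathbb R^l,\mathbb R^k)\to J^1(V,\mathbb R)=V\times\mathbb R\times V$ is the polynomial map $$u(x,h,A)=\Big(x,\ \sum_ih_iF_i(x),\ \sum_i\big(h_i\nabla F_i(x)+F_i(x)\sum_{j=1}^lA_{ij}\nabla p_j(x)\big)\Big).$$ Let $Z=\{(x,y,g)\in V\times\mathbb R\times V:\operatorname{rank}[x\,|\,g]\le1\}$ and let $\mathcal U_{(V,G)}$ be the canonical stratification of $u^{-1}(Z)$. The germ $f$ is $\mho$-regular (in the $G$-equivariant sense) if the map $x\mapsto(x,H^1(P(x)))$ is transverse to $\mathcal U_{(V,G)}$ on a neighbourhood of $0$. This notion is independent of the choices of generators and of $H$. *)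

(* Defs.v *)
From HB Require Import structures.
From mathcomp Require Import all_boot all_order all_algebra all_fingroup.
From mathcomp Require Import all_classical all_reals all_analysis.
(* The notations of mpoly clash with those of mathcomp-analysis. *)
From mathcomp Require mpoly.
Import -(notations) mpoly.

Set Implicit Arguments.
Unset Strict Implicit.
Unset Printing Implicit Defensive.

Import Order.TTheory GRing.Theory Num.Theory.
Import numFieldNormedType.Exports.

Local Open Scope classical_set_scope.
Local Open Scope ring_scope.

Section Smooth.
Context {R : realType} {E F : normedModType R}.

Definition iterD (vs : seq E) (f : E -> F) : E -> F :=
  foldr (fun v g => 'D_v g) f vs.

(* For finite-dimensional E and open A this is C^infinity on A: every iterated
   directional derivative exists and is Frechet differentiable on A. *)
Definition smooth_on (A : set E) (f : E -> F) : Prop :=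
  forall x, A x -> forall vs : seq E, differentiable (iterD vs f) x.

Definition smooth_near (x : E) (f : E -> F) : Prop :=
  exists2 A : set E, open_nbhs x A & smooth_on A f.

(* \sum_(j <= r) D^j f(0)(x, ..., x) / j! *)
Definition taylor0 (r : nat) (f : E -> F) (x : E) : F :=
  \sum_(j < r.+1) (j`!%:R)^-1 *: iterD (nseq j x) f 0.

End Smooth.

Section Stratifications.
Context {R : realType} {N : nat}.
Implicit Types (M X : set 'rV[R]_N) (S : set (set 'rV[R]_N)).

(* Embedded submanifolds, by slice charts phi : A -> B with inverse psi. *)
Definition submanifold (m : nat) M : Prop :=
  (m <= N)%N /\
  forall x, M x ->
  exists (A B : set 'rV[R]_N) (phi psi : 'rV[R]_N -> 'rV[R]_N),
    [/\ open_nbhs x A /\ open B,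
        smooth_on A phi /\ smooth_on B psi,
        (forall y, A y -> B (phi y) /\ psi (phi y) = y),
        (forall z, B z -> A (psi z) /\ phi (psi z) = z) &
        forall y, A y ->
          M y <-> (forall i : 'I_N, (m <= i)%N -> phi y 0 i = 0)].

Definition tangent_space M (x : 'rV[R]_N) : set 'rV[R]_N :=
  [set v | exists c : R -> 'rV[R]_N,
    [/\ smooth_near (0 : R) c, (\forall t \near (0 : R), M (c t)),
        c 0 = x & 'D_1 c 0 = v]].

Definition basis_rows (m : nat) (b : 'M[R]_(m, N)) (T : set 'rV[R]_N) : Prop :=
  row_free b /\ T = [set v | (v <= b)%MS].

(* Convergence in the Grassmannian of m-planes, as the quotient of the space
   of m-frames. *)
Definition grassmann_cvg (m : nat) (T : nat -> set 'rV[R]_N)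
    (T0 : set 'rV[R]_N) : Prop :=
  exists (b : nat -> 'M[R]_(m, N)) (b0 : 'M[R]_(m, N)),
    [/\ (forall n, basis_rows (b n) (T n)), basis_rows b0 T0 &
        b @ \oo --> b0].

Definition line (v : 'rV[R]_N) : set 'rV[R]_N := [set w | exists a, w = a *: v].

(* Condition (b) for the pair (M', M), at all points y of M; m = dim M'. *)
Definition whitney_b (m : nat) (M' M : set 'rV[R]_N) : Prop :=
  forall (y : 'rV[R]_N) (xs ys : nat -> 'rV[R]_N) (L T : set 'rV[R]_N),
    M y -> (forall n, M' (xs n)) -> (forall n, M (ys n)) ->
    xs @ \oo --> y -> ys @ \oo --> y -> (forall n, xs n != ys n) ->
    grassmann_cvg 1 (fun n => line (xs n - ys n)) L ->
    grassmann_cvg m (fun n => tangent_space M' (xs n)) T ->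
    L `<=` T.

Definition stratification X S : Prop :=
  [/\ partition S id X,
      (forall M, S M -> exists m, submanifold m M) &
      forall x, X x -> exists2 A, nbhs x A &
        finite_set [set M | S M /\ M `&` A !=set0]].

Definition whitney_stratification X S : Prop :=
  stratification X S /\
  forall (m : nat) M' M, S M' -> S M -> M' <> M -> submanifold m M' ->
    whitney_b m M' M.

Definition skeleton S (i : nat) : set 'rV[R]_N :=
  [set x | exists M m, [/\ S M, submanifold m M, (m <= i)%N & M x]].

Definition strat_lt S S' : Prop :=
  exists i, skeleton S i `<` skeleton S' i /\
    forall j, (i < j)%N -> skeleton S j = skeleton S' j.

Definition canonical_stratification X S : Prop :=
  whitney_stratification X S /\
  forall S', whitney_stratification X S' -> ~ strat_lt S' S.

Definition transverse_at (E : normedModType R) (phi : E -> 'rV[R]_N)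
    M (x : E) : Prop :=
  M (phi x) -> forall w : 'rV[R]_N, exists (v : E) (t : 'rV[R]_N),
    tangent_space M (phi x) t /\ w = 'd phi x v + t.

Definition transverse_to_strat (E : normedModType R) (phi : E -> 'rV[R]_N)
    S (A : set E) : Prop :=
  forall M, S M -> forall x, A x -> transverse_at phi M x.

End Stratifications.

Section Invariants.
Context {R : realType} {gT : finGroupType} {d : nat}.
Variable to : {action gT &-> 'I_d}.

(* g maps the basis vector e_i to e_(g i). *)
Definition perm_act (g : gT) (x : 'rV[R]_d) : 'rV[R]_d :=
  \sum_(i < d) x 0 i *: delta_mx 0 (to i g).

Definition peval (q : mpoly d R) (x : 'rV[R]_d) : R :=
  meval (x 0) q.

Definition pgrad (q : mpoly d R) (x : 'rV[R]_d) : 'rV[R]_d :=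
  \row_(j < d) peval (mderiv j q) x.

Definition homogeneous (q : mpoly d R) : Prop :=
  exists e : nat, q \is ishomog1 e mdeg.

Definition inv_poly (q : mpoly d R) : Prop :=
  forall g x, peval q (perm_act g x) = peval q x.

Definition inv_poly0 (q : mpoly d R) : Prop :=
  [/\ inv_poly q, peval q 0 = 0 & pgrad q 0 = 0].

Definition drop_tuple (T : Type) (n : nat) (t : n.-tuple T) (i : 'I_n) :
    n.-1.-tuple T :=
  [tuple tnth t (lift i j) | j < n.-1].

Definition generates_invariants (l : nat) (p : l.-tuple (mpoly d R)) :=
  forall q, inv_poly q ->
    exists c : mpoly l R, q = comp_mpoly p c.

Definition minimal_invariant_generators (l : nat)
    (p : l.-tuple (mpoly d R)) : Prop :=
  [/\ (forall i, inv_poly (tnth p i) /\ homogeneous (tnth p i)),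
      generates_invariants p &
      forall i, ~ generates_invariants (drop_tuple p i)].

Definition generates_inv0 (k : nat) (F : k.-tuple (mpoly d R)) :=
  forall q, inv_poly0 q ->
    exists c : 'I_k -> mpoly d R,
      (forall i, inv_poly (c i)) /\ q = \sum_(i < k) c i * tnth F i.

Definition minimal_inv0_generators (k : nat)
    (F : k.-tuple (mpoly d R)) : Prop :=
  [/\ (forall i, inv_poly0 (tnth F i) /\ homogeneous (tnth F i)),
      generates_inv0 F &
      forall i, ~ generates_inv0 (drop_tuple F i)].

(* Germs at 0 are represented by functions defined on all of V. *)
Definition smooth_invariant_germ (f : 'rV[R]_d -> R) : Prop :=
  smooth_near 0 f /\
  \forall x \near (0 : 'rV[R]_d), forall g, f (perm_act g x) = f x.

End Invariants.

Section Regularity.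
Context {R : realType} {d l k : nat}.
Variables (p : l.-tuple (mpoly d R)) (F : k.-tuple (mpoly d R)).

Definition orbit_map (x : 'rV[R]_d) : 'rV[R]_l :=
  \row_(j < l) peval (tnth p j) x.

Definition u_map (x : 'rV[R]_d) (h : 'rV[R]_k) (A : 'M[R]_(k, l)) :
    'rV[R]_d * R * 'rV[R]_d :=
  (x,
   \sum_(i < k) h 0 i * peval (tnth F i) x,
   \sum_(i < k) (h 0 i *: pgrad (tnth F i) x +
     peval (tnth F i) x *: \sum_(j < l) A i j *: pgrad (tnth p j) x)).

Definition Zset : set ('rV[R]_d * R * 'rV[R]_d) :=
  [set w | (\rank (row_mx (w.1.1)^T (w.2)^T) <= 1)%N].

(* Coordinates (x, h, A) on V x P^1(R^l, R^k). *)
Definition jcoord (x : 'rV[R]_d) (h : 'rV[R]_k) (A : 'M[R]_(k, l)) :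
    'rV[R]_(d + (k + k * l)) :=
  row_mx x (row_mx h (mxvec A)).

Definition u_preim_Z : set 'rV[R]_(d + (k + k * l)) :=
  [set w | exists x h A, w = jcoord x h A /\ Zset (u_map x h A)].

(* 'J H y has entries D_j h_i in row j and column i. *)
Definition H1_section (H : 'rV[R]_l -> 'rV[R]_k) (x : 'rV[R]_d) :
    'rV[R]_(d + (k + k * l)) :=
  jcoord x (H (orbit_map x)) ('J H (orbit_map x))^T.

Definition mho_regular (U : set (set 'rV[R]_(d + (k + k * l))))
    (f : 'rV[R]_d -> R) : Prop :=
  exists H : 'rV[R]_l -> 'rV[R]_k,
    [/\ smooth_on setT H,
        (\forall x \near (0 : 'rV[R]_d),
           f x = \sum_(i < k) H (orbit_map x) 0 i * peval (tnth F i) x) &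
        exists2 A : set 'rV[R]_d, nbhs (0 : 'rV[R]_d) A &
          transverse_to_strat (H1_section H) U A].

End Regularity.

(* Main.v *)
(* Write y0 = P(0).  For r large, the weighted homogeneous truncation H' of the
   Taylor polynomial of H at y0 satisfies T_0^r f = sum_i (H'_i o P) F_i: after
   restriction to a line t |-> t x both sides are polynomials in t of degree at
   most r that agree with f(t x) up to O(t^(r+1)).  If moreover r is at least
   twice the degrees of the p_j plus the degrees of the F_i, the truncation
   drops no monomial of degree at most 2, so H and H' have the same 2-jet at y0
   and the sections x |-> (x, H^1(P(x))), x |-> (x, H'^1(P(x))) the same 1-jet
   at 0.  Transversality at 0 therefore passes from H to H', and spreads to a
   neighbourhood of 0 because transversality to a stratification satisfying
   Whitney's condition (a), which follows from (b), is an open condition. *)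
Require Import Defs.
From HB Require Import structures.
From mathcomp Require Import all_boot all_order all_algebra all_fingroup.
From mathcomp Require Import all_classical all_reals all_analysis.
From mathcomp Require mpoly.
Import -(notations) mpoly.
From mathcomp Require Import ring lra.

Import Order.TTheory GRing.Theory Num.Theory.
Import numFieldNormedType.Exports.

Local Open Scope classical_set_scope.
Local Open Scope ring_scope.

Set Implicit Arguments.
Unset Strict Implicit.
Unset Printing Implicit Defensive.

(* ssrnat has a lemma of the same name. *)
Local Notation iterD := Defs.iterD.

(** * Iterated directional derivatives *)

Section Calculus.
Context {R : realType}.

(** [mho_regular] asks for some H, so it suffices to exhibit one H' that represents the Taylor
    polynomial. The 2-jet of H at P(0) has to be kept, and not only the 1-jet, because the section
    already contains DH and transversality at 0 involves the differential of the section. The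
    obstacle in spreading transversality is that non-transverse points x_n tending to 0 may be
    mapped into a stratum M that merely accumulates at the image of 0, while that image lies in
    another stratum M0. Failure of transversality is therefore recorded by unit covectors that
    annihilate both the image of the differential and the tangent space of M. This condition
    survives passage to a limit, and condition (a) turns the limit into a covector annihilating the
    tangent space of M0, which contradicts transversality to M0 at 0. A stratum M0 through the image
    of 0 exists for every H, since at x = 0 the section always lies in the preimage of Z. *)

Lemma differentiable_rowP (E : normedModType R) (n : nat)
    (f : E -> 'rV[R]_n) (x : E) :
  (forall i, differentiable (fun y => f y 0 i) x) -> differentiable f x.
Proof.
move=> df.
have -> : f = \sum_(i < n) (fun y => f y 0 i *: (delta_mx 0 i : 'rV[R]_n)).
  by apply/funext => y; rewrite fct_sumE [LHS]row_sum_delta.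
by apply: differentiable_sum => i; apply: differentiableZl.
Qed.

Lemma differentiable_entry (E : normedModType R) (m n : nat)
    (f : E -> 'M[R]_(m, n)) (x : E) i j :
  differentiable f x -> differentiable (fun y => f y i j) x.
Proof.
move=> df.
by apply: (@differentiable_comp _ _ _ _ f (fun M : 'M[R]_(m, n) => M i j)) => //;
  apply: differentiable_coord.
Qed.

Lemma derive_entry (E : normedModType R) (n : nat)
    (f : E -> 'rV[R]_n) (x v : E) i :
  differentiable f x -> ('D_v f x) 0 i = 'D_v (fun y => f y 0 i) x.
Proof. by move=> df; rewrite derive_mx ?mxE//; exact: diff_derivable. Qed.

Section IteratedDerivatives.
Context {E F : normedModType R}.
Implicit Types (A : set E) (f g : E -> F).

Lemma derive_eq_on A f g v : open A -> (forall x, A x -> f x = g x) ->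
  forall x, A x -> 'D_v f x = 'D_v g x.
Proof.
move=> oA fg x Ax; apply: near_eq_derive.
by apply: filterS (open_nbhs_nbhs (conj oA Ax)) => y; apply: fg.
Qed.

Lemma iterD_eq_on A f g vs : open A -> (forall x, A x -> f x = g x) ->
  forall x, A x -> iterD vs f x = iterD vs g x.
Proof. by move=> oA fg; elim: vs => [//|v vs IH] x Ax /=; exact: derive_eq_on IH _ Ax. Qed.

Lemma iterD_rcons vs v f : iterD (rcons vs v) f = iterD vs ('D_v f).
Proof. by rewrite /iterD -cats1 foldr_cat. Qed.

Lemma iterD_nseqS j v f : iterD (nseq j.+1 v) f = iterD (nseq j v) ('D_v f).
Proof. by rewrite -iterD_rcons; congr iterD; elim: j => //= j <-. Qed.

Lemma smooth_on_derive A f v : smooth_on A f -> smooth_on A ('D_v f).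
Proof. by move=> sf x Ax vs; rewrite -iterD_rcons; apply: sf. Qed.

Lemma iterD_sumZ A n (c : 'I_n -> R) (f : 'I_n -> E -> F) vs : open A ->
  (forall i, smooth_on A (f i)) -> forall x, A x ->
  iterD vs (fun y => \sum_i c i *: f i y) x = \sum_i c i *: iterD vs (f i) x.
Proof.
move=> oA sf; elim: vs => [//|v vs IH] x Ax /=.
rewrite (derive_eq_on _ oA IH Ax).
have -> : (fun y => \sum_i c i *: iterD vs (f i) y) =
  \sum_i (c i \*: iterD vs (f i)) by apply/funext => y; rewrite fct_sumE.
have dv i : derivable (iterD vs (f i)) x v by apply/diff_derivable/sf.
rewrite derive_sum; last by move=> i; apply: derivableZ.
by apply: eq_bigr => i _; rewrite deriveZ.
Qed.

End IteratedDerivatives.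

Lemma derive_row_sum (n : nat) (F : normedModType R) (f : 'rV[R]_n -> F) x v :
  differentiable f x ->
  'D_v f x = \sum_i v 0 i *: 'D_(delta_mx 0 i) f x.
Proof.
move=> df; rewrite deriveE// {1}[v]row_sum_delta linear_sum/=.
by apply: eq_bigr => i _; rewrite linearZ/= deriveE.
Qed.

End Calculus.

(** * Taylor's formula *)

Section Taylor.
Context {R : realType}.

(** The innermost derivative along z is expanded in partial derivatives, and the constants [z 0 i]
    leave the remaining ones. This gives a recursion on j in which h is replaced by its partial
    derivatives; polynomiality, bounds and homogeneity in z all follow from it. *)
Lemma iterD_nseq_coords (n j : nat) (A : set 'rV[R]_n) (h : 'rV[R]_n -> R) z x :
  open A -> smooth_on A h -> A x ->
  iterD (nseq j.+1 z) h x =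
  \sum_i z 0 i * iterD (nseq j z) ('D_(delta_mx 0 i) h) x.
Proof.
move=> oA sh Ax; rewrite iterD_nseqS.
rewrite (iterD_eq_on _ oA (g := fun y => \sum_i z 0 i *: 'D_(delta_mx 0 i) h y))//.
  by apply: (iterD_sumZ _ _ oA) => // i; apply: smooth_on_derive.
by move=> y Ay; rewrite derive_row_sum//; apply: (sh y Ay [::]).
Qed.

(** [taylor0] differentiates along its own argument, so its terms are not polynomials by
    construction. *)
Lemma iterD_nseq_poly (n j : nat) (A : set 'rV[R]_n) (h : 'rV[R]_n -> R) x :
  open A -> smooth_on A h -> A x ->
  exists q : mpoly n R, forall z, iterD (nseq j z) h x = peval q z.
Proof.
move=> oA sh Ax; elim: j h sh => [|j IH] h sh.
  by exists (mpolyC n (h x)) => z; rewrite /peval mevalC.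
have /(_ _)/cid-/all_sig[q qE] := fun i =>
  IH _ (smooth_on_derive (delta_mx 0 i) sh).
exists (\sum_i mpolyX R (mnm1 i) * q i) => z.
rewrite (iterD_nseq_coords _ _ oA)// /peval raddf_sum/=.
by apply: eq_bigr => i _; rewrite mevalM mevalXU qE.
Qed.

Lemma normr_entry (m n : nat) (z : 'M[R]_(m, n)) i j : `|z i j| <= `|z|.
Proof. by rewrite [leRHS]/Num.Def.normr/= mx_normrE; exact: (le_bigmax _ _ (i, j)). Qed.

Lemma iterD_nseq_bound (n j : nat) (A : set 'rV[R]_n) (h : 'rV[R]_n -> R) x :
  open A -> smooth_on A h -> A x ->
  exists2 C : R, 0 <= C &
    \forall y \near x, forall z, `|iterD (nseq j z) h y| <= C * `|z| ^+ j.
Proof.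
move=> oA sh Ax; have nA := open_nbhs_nbhs (conj oA Ax).
elim: j h sh => [|j IH] h sh.
  have ch : {for x, continuous h}.
    by apply: differentiable_continuous; exact: (sh x Ax [::]).
  exists (`|h x| + 1); first by rewrite addr_ge0.
  have /cvgrPdist_lt/(_ 1 ltr01) : h @ x --> h x by exact: ch.
  apply: filterS => y hy z /=; rewrite expr0 mulr1.
  rewrite -lerBlDl; apply: le_trans (ltW hy).
  by rewrite distrC; apply: lerB_dist.
have /(_ _)/cid2-/all_sig2[C C0 HC] := fun i =>
  IH _ (smooth_on_derive (delta_mx 0 i) sh).
exists (\sum_i C i); first by apply: sumr_ge0.
have HC' : \forall y \near x, forall i z,
    `|iterD (nseq j z) ('D_(delta_mx 0 i) h) y| <= C i * `|z| ^+ j.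
  exact: (@filter_forall _ _ (fun i y => forall z,
    `|iterD (nseq j z) ('D_(delta_mx 0 i) h) y| <= C i * `|z| ^+ j) (nbhs x) _ HC).
apply: filterS2 nA HC' => y Ay Hy z.
rewrite (iterD_nseq_coords _ _ oA)// mulr_suml (le_trans (ler_norm_sum _ _ _))//.
apply: ler_sum => i _; rewrite normrM exprS mulrCA.
by apply: ler_pM => //; exact: normr_entry.
Qed.

Lemma is_derive_line (n : nat) (F : normedModType R) (A : set 'rV[R]_n)
    (h : 'rV[R]_n -> F) j x z t :
  smooth_on A h -> A (x + t *: z) ->
  is_derive t (1 : R) (fun t : R => iterD (nseq j z) h (x + t *: z))
    (iterD (nseq j.+1 z) h (x + t *: z)).
Proof.
move=> sh Ax; have dh := sh _ Ax (nseq j z).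
have dl : is_diff t (fun t : R => x + t *: z) (fun s : R => s *: z).
  have -> : (fun t : R => x + t *: z) = cst x + *:%R^~ z by [].
  have h1 : is_diff t (cst x : R -> 'rV[R]_n) 0 by exact: is_diff_cst.
  have h2 : is_diff t ( *:%R^~ z : R -> 'rV[R]_n) ( *:%R^~ z) by exact: is_diff_scalel.
  by apply: is_diff_eq (is_diffD h1 h2) _; rewrite add0r.
have dc : differentiable (iterD (nseq j z) h \o (fun t : R => x + t *: z)) t.
  by apply: differentiable_comp; [exact: (@ex_diff _ _ _ _ _ _ _ dl)|exact: dh].
split; first exact: diff_derivable.
rewrite deriveE//= diff_comp//.
by rewrite /= diff_val scale1r deriveE.
Qed.

Lemma taylor_remainder (n s : nat) (A : set 'rV[R]_n) (h : 'rV[R]_n -> R) x :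
  open A -> smooth_on A h -> A x ->
  exists2 C : R, 0 <= C & \forall z \near (0 : 'rV[R]_n),
    `|h (x + z) - \sum_(j < s.+1) (j`!%:R)^-1 * iterD (nseq j z) h x|
      <= C * `|z| ^+ s.+1.
Proof.
move=> oA sh Ax; have nA := open_nbhs_nbhs (conj oA Ax).
have [C C0 HC] := iterD_nseq_bound s.+1 oA sh Ax.
exists C => //.
have /nbhs_ballP[e /= e0 He] : nbhs x [set y | A y /\ forall z,
  `|iterD (nseq s.+1 z) h y| <= C * `|z| ^+ s.+1].
  exact: filterI nA HC.
apply/nbhs_ballP; exists e => //= z; rewrite -ball_normE/= sub0r normrN => ze.
have He' (t : R) : 0 <= t <= 1 -> A (x + t *: z) /\
    `|iterD (nseq s.+1 z) h (x + t *: z)| <= C * `|z| ^+ s.+1.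
  move=> /andP[t0 t1].
  have /He[? Hz] : ball x e (x + t *: z).
    rewrite -ball_normE/= opprD addrA subrr sub0r normrN normrZ ger0_norm//.
    by apply: le_lt_trans ze; rewrite ler_piMl.
  by split => //; exact: Hz.
pose g j (t : R) : R := iterD (nseq j z) h (x + t *: z).
(* Expanding h about the moving point x + t z and evaluating at x + z gives G: it joins the Taylor
   polynomial at t = 0 to h (x + z) at t = 1. Its derivative telescopes to the term of order s + 1,
   so the mean value theorem yields the Cauchy remainder. *)
pose G (t : R) : R := \sum_(j < s.+1) (j`!%:R)^-1 * ((1 - t) ^+ j * g j t).
have dg j (t : R) : 0 <= t <= 1 -> is_derive t (1 : R) (g j) (g j.+1 t).
  by move=> /He'[At _]; exact: is_derive_line sh At.
have dG (t : R) : 0 <= t <= 1 ->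
    is_derive t (1 : R) G ((s`!%:R)^-1 * ((1 - t) ^+ s * g s.+1 t)).
  move=> t01.
  have -> : G = \sum_(j < s.+1) ((j`!%:R)^-1 \*: ((fun t : R => (1 - t) ^+ j) * g j)).
    by apply/funext => u; rewrite fct_sumE.
  have d1 : is_derive t (1 : R) (fun t : R => 1 - t) (-1).
    have -> : (fun t : R => 1 - t) = cst 1 - id by [].
    by apply: is_derive_eq; rewrite sub0r.
  have dj j : is_derive t (1 : R) ((j`!%:R)^-1 \*: ((fun t : R => (1 - t) ^+ j) * g j))
     ((j`!%:R)^-1 * ((1 - t) ^+ j * g j.+1 t) -
      (if j is j'.+1 then (j'`!%:R)^-1 * ((1 - t) ^+ j' * g j'.+1 t) else 0)).
    have := dg j t t01 => dgj.
    have -> : (fun t : R => (1 - t) ^+ j) = (fun t : R => 1 - t) ^+ j.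
      by elim: j {dgj} => [//|j IH]; rewrite exprS -IH; apply/funext => u; rewrite exprS.
    have := is_deriveZ (j`!%:R)^-1 (is_deriveM (is_deriveX j d1) dgj) => /is_derive_eq; apply.
    have XE : ((fun t0 : R => 1 - t0) ^+ j) t = (1 - t) ^+ j.
      by elim: j {dgj} => [//|j IH]; rewrite !exprS -IH.
    rewrite XE /GRing.scale/=; case: j {dgj XE} => [|j].
      by rewrite mul0r mul0r mulr0 addr0 subr0.
    have j1 : j.+1%:R != 0 :> R by rewrite pnatr_eq0.
    have j2 : j`!%:R != 0 :> R by rewrite pnatr_eq0 -lt0n fact_gt0.
    rewrite factS natrM; field.
by rewrite nat1r j1 j2.
  apply: is_derive_eq (is_derive_sum dj) _.
  rewrite big_split/= sumrN big_ord_recr/= [X in _ - X]big_ord_recl/= add0r.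
  by rewrite addrAC subrr add0r.
have cG : {within `[0, 1], continuous G}.
  apply: continuous_in_subspaceT => t; rewrite inE/= in_itv/= => t01.
  apply: differentiable_continuous; apply/derivable1_diffP.
  exact: (@ex_derive _ _ _ _ _ _ _ (dG t t01)).
have [|c] := MVT_segment (f := G)
  (df := fun t => (s`!%:R)^-1 * ((1 - t) ^+ s * g s.+1 t)) ler01 _ cG.
  by move=> t; rewrite in_itv/= => /andP[? ?]; apply: dG; rewrite !ltW.
rewrite in_itv/= => c01; rewrite subr0 mulr1.
have -> : G 1 = h (x + z).
  rewrite /G big_ord_recl big1 ?addr0/=.
    by rewrite invr1 expr0 !mul1r /g/= scale1r.
  by move=> i _; rewrite subrr expr0n/= mul0r mulr0.
have -> : G 0 = \sum_(j < s.+1) (j`!%:R)^-1 * iterD (nseq j z) h x.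
  by apply: eq_bigr => j _; rewrite subr0 expr1n mul1r /g scale0r addr0.
move=> ->; rewrite !normrM.
have [_ Hc] := He' c c01.
rewrite -[leRHS]mul1r; apply: ler_pM => //.
  rewrite normfV ger0_norm// invf_le1 ?ltr0n ?fact_gt0//.
  by rewrite ler1n fact_gt0.
rewrite -[leRHS]mul1r; apply: ler_pM => //.
rewrite normrX exprn_ile1//.
by case/andP: c01 => c0 c1; rewrite ger0_norm ?subr_ge0// gerBl.
Qed.
End Taylor.

(** * Polynomial maps and vanishing 2-jets *)

Section PolynomialFunctions.
Context {R : realType}.

(** Closure under sums and products is stated for functions, so that differentiability and stability
    under composition and directional derivatives follow by induction, without handling
    coefficients. *)
Inductive polyfun {n : nat} : ('rV[R]_n -> R) -> Prop :=
| polyfun_cst c : polyfun (fun=> c)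
| polyfun_coord i : polyfun (fun x => x 0 i)
| polyfunD f g : polyfun f -> polyfun g -> polyfun (fun x => f x + g x)
| polyfunM f g : polyfun f -> polyfun g -> polyfun (fun x => f x * g x).

Lemma polyfun_sum n (I : Type) (r : seq I) (P : pred I)
    (f : I -> 'rV[R]_n -> R) :
  (forall i, polyfun (f i)) -> polyfun (fun x => \sum_(i <- r | P i) f i x).
Proof.
move=> pf; elim: r => [|i r IH].
  by under eq_fun do rewrite big_nil; exact: polyfun_cst.
under eq_fun do rewrite big_cons; case: (P i) => //.
exact: polyfunD.
Qed.

Lemma polyfun_prod n (I : Type) (r : seq I) (f : I -> 'rV[R]_n -> R) :
  (forall i, polyfun (f i)) -> polyfun (fun x => \prod_(i <- r) f i x).
Proof.
move=> pf; elim: r => [|i r IH].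
  by under eq_fun do rewrite big_nil; exact: polyfun_cst.
by under eq_fun do rewrite big_cons; exact: polyfunM.
Qed.

Lemma polyfunX n j (f : 'rV[R]_n -> R) :
  polyfun f -> polyfun (fun x => f x ^+ j).
Proof.
move=> pf; elim: j => [|j IH].
  by under eq_fun do rewrite expr0; exact: polyfun_cst.
by under eq_fun do rewrite exprS; exact: polyfunM.
Qed.

Lemma polyfun_comp n m (f : 'rV[R]_n -> R) (g : 'rV[R]_m -> 'rV[R]_n) :
  polyfun f -> (forall i, polyfun (fun x => g x 0 i)) -> polyfun (f \o g).
Proof.
move=> pf pg; elim: pf => [c|i|f1 f2 _ p1 _ p2|f1 f2 _ p1 _ p2].
- exact: polyfun_cst.
- exact: pg.
- exact: (polyfunD p1 p2).
- exact: (polyfunM p1 p2).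
Qed.

Lemma polyfun_meval n m (q : mpoly n R) (g : 'I_n -> 'rV[R]_m -> R) :
  (forall i, polyfun (g i)) -> polyfun (fun x => meval (g ^~ x) q).
Proof.
move=> pg; under eq_fun do rewrite mevalE.
apply: polyfun_sum => u; apply: polyfunM; first exact: polyfun_cst.
by apply: polyfun_prod => i; apply: polyfunX.
Qed.

Lemma polyfun_peval n (q : mpoly n R) : polyfun (peval q).
Proof. by apply: (@polyfun_meval _ _ q (fun i x => x 0 i)) => i; exact: polyfun_coord. Qed.

Lemma polyfun_differentiable n (f : 'rV[R]_n -> R) x :
  polyfun f -> differentiable f x.
Proof.
elim=> [c|i|f1 f2 _ d1 _ d2|f1 f2 _ d1 _ d2].
- exact: differentiable_cst.
- exact: differentiable_coord.
- exact: differentiableD.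
- exact: differentiableM.
Qed.

Lemma polyfun_derive n (f : 'rV[R]_n -> R) v :
  polyfun f -> polyfun ('D_v f).
Proof.
elim=> [c|i|f1 f2 p1 d1 p2 d2|f1 f2 p1 d1 p2 d2].
- by rewrite (_ : 'D_v _ = fun=> 0); [exact: polyfun_cst|apply/funext => x; rewrite derive_cst].
- rewrite (_ : 'D_v _ = fun=> v 0 i); [exact: polyfun_cst|apply/funext => x].
  by rewrite -(@derive_entry _ _ _ id)// derive_id.
- rewrite (_ : 'D_v _ = fun x => 'D_v f1 x + 'D_v f2 x); first exact: polyfunD.
  by apply/funext => x; rewrite deriveD//; apply/diff_derivable/polyfun_differentiable.
- rewrite (_ : 'D_v _ = fun x => f1 x * 'D_v f2 x + f2 x * 'D_v f1 x).
    by apply: polyfunD; apply: polyfunM.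
  by apply/funext => x; rewrite deriveM//; apply/diff_derivable/polyfun_differentiable.
Qed.

Definition polymap {n m} (f : 'rV[R]_n -> 'rV[R]_m) :=
  forall i, polyfun (fun x => f x 0 i).

Lemma polymap_differentiable n m (f : 'rV[R]_n -> 'rV[R]_m) x :
  polymap f -> differentiable f x.
Proof. by move=> pf; apply: differentiable_rowP => i; exact: polyfun_differentiable. Qed.

Lemma polymap_derive n m (f : 'rV[R]_n -> 'rV[R]_m) v :
  polymap f -> polymap ('D_v f).
Proof.
move=> pf i; rewrite (_ : (fun _ => _) = 'D_v (fun x => f x 0 i)).
  exact/polyfun_derive/pf.
by apply/funext => x; rewrite derive_entry//; exact: polymap_differentiable.
Qed.

Lemma polymap_smooth n m (f : 'rV[R]_n -> 'rV[R]_m) :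
  polymap f -> smooth_on setT f.
Proof.
move=> pf x _ vs; apply: polymap_differentiable.
by elim: vs => //= v vs; exact: polymap_derive.
Qed.

Lemma polymap_continuous n m (f : 'rV[R]_n -> 'rV[R]_m) : polymap f -> continuous f.
Proof. by move=> pf x; apply/differentiable_continuous/polymap_differentiable. Qed.

Lemma polymap_diff_continuous n m (f : 'rV[R]_n -> 'rV[R]_m) v :
  polymap f -> continuous (fun x => 'd f x v).
Proof.
move=> pf; rewrite (_ : (fun _ => _) = 'D_v f).
  exact/polymap_continuous/polymap_derive.
by apply/funext => x; rewrite deriveE//; exact: polymap_differentiable.
Qed.

End PolynomialFunctions.

(** * Vanishing derivatives from decay of third order *)

Section Orders.
Context {R : realType}.

Lemma mvt0 (g dg : R -> R) (t : R) : 0 <= t ->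
  (forall s : R, is_derive s (1 : R) g (dg s)) ->
  exists2 u : R, 0 <= u <= t & g t - g 0 = dg u * t.
Proof.
move=> t0 Hg.
have cg : {within `[0, t], continuous g}.
  apply: continuous_subspaceT => s; apply: differentiable_continuous.
  by apply/derivable1_diffP; exact: (@ex_derive _ _ _ _ _ _ _ (Hg s)).
have [u] := MVT_segment t0 (fun s _ => Hg s) cg.
by rewrite in_itv/= subr0 => u0t gE; exists u.
Qed.

(** The mean value theorem gives information only at an unspecified point within O(t) of x;
    continuity transfers it to x itself. *)
Lemma continuous_small_eq0 n (g : 'rV[R]_n -> R) x (K M : R) :
  {for x, continuous g} ->
  (\forall t \near (0 : R)^'+, exists y,
     `|x - y| <= M * t /\ `|g y| <= K * t) ->
  g x = 0.
Proof.
move=> cg H; apply/eqP/negP => /negP gx0.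
have e0 : 0 < `|g x| / 2 by rewrite divr_gt0// normr_gt0.
have /cvgrPdist_lt/(_ _ e0)/nbhs_ballP[d /= d0 Hd] : g @ x --> g x by exact: cg.
near (0 : R)^'+ => t.
have t0 : 0 < t by near: t; exact: nbhs_right_gt.
have [|y [xy gy]] := near H t; first by [].
have {}xy : ball x d y.
  rewrite -ball_normE/=; apply: le_lt_trans xy _.
  apply: (@le_lt_trans _ _ (`|M| * t)); first by rewrite ler_pM2r// ler_norm.
  have : t < d / (`|M| + 1).
    by near: t; apply: nbhs_right_lt; rewrite divr_gt0// ltr_wpDl.
  rewrite ltr_pdivlMr ?ltr_wpDl// => tM.
  by apply: le_lt_trans tM; rewrite mulrDr mulr1 mulrC lerDl ltW.
have /= := Hd y xy.
have gy2 : `|g y| < `|g x| / 2.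
  apply: le_lt_trans gy _.
  apply: (@le_lt_trans _ _ (`|K| * t)); first by rewrite ler_pM2r// ler_norm.
  have : t < (`|g x| / 2) / (`|K| + 1).
    by near: t; apply: nbhs_right_lt; rewrite divr_gt0// ltr_wpDl.
  rewrite ltr_pdivlMr ?ltr_wpDl// => tM.
  by apply: le_lt_trans tM; rewrite mulrDr mulr1 mulrC lerDl ltW.
move=> H1; have := lerB_dist (g x) (g y).
by lra.
Unshelve. all: by end_near. Qed.

Lemma near_norm_right n (P : set 'rV[R]_n) (K : R) :
  (\forall z \near (0 : 'rV[R]_n), P z) ->
  \forall t \near (0 : R)^'+, forall z, `|z| <= K * t -> P z.
Proof.
move=> /nbhs_ballP[d /= d0 Hd].
near=> t => z zt; apply: Hd; rewrite -ball_normE/= sub0r normrN.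
have t0 : 0 < t by near: t; exact: nbhs_right_gt.
apply: le_lt_trans zt _.
apply: (@le_lt_trans _ _ (`|K| * t)); first by rewrite ler_pM2r// ler_norm.
have : t < d / (`|K| + 1).
  by near: t; apply: nbhs_right_lt; rewrite divr_gt0// ltr_wpDl.
rewrite ltr_pdivlMr ?ltr_wpDl// => tM.
by apply: le_lt_trans tM; rewrite mulrDr mulr1 mulrC lerDl ltW.
Unshelve. all: by end_near. Qed.

Section Jets.
Variables (n : nat) (W : 'rV[R]_n -> R) (x : 'rV[R]_n) (C : R).
Hypotheses (sW : smooth_on setT W) (C0 : 0 <= C)
  (W3 : \forall z \near (0 : 'rV[R]_n), `|W (x + z)| <= C * `|z| ^+ 3).

Lemma order3_eq0 : W x = 0.
Proof.
have := nbhs_singleton W3; rewrite addr0 normr0 expr0n mulr0.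
by rewrite normr_le0 => /eqP.
Qed.

Lemma order3_derive_eq0 b : 'D_b W x = 0.
Proof.
apply: (@continuous_small_eq0 _ ('D_b W) x (C * `|b| ^+ 3) `|b|).
  by apply: differentiable_continuous; exact: (@sW x I [:: b]).
have HW := near_norm_right `|b| W3.
near=> t.
have t0 : 0 < t by near: t; exact: nbhs_right_gt.
have t1 : t < 1 by near: t; exact: nbhs_right_lt.
have [u /andP[u0 ut] uE] := mvt0 (ltW t0)
  (fun s => @is_derive_line _ _ _ _ _ 0 x b s sW I).
exists (x + u *: b); split.
  by rewrite opprD addrA subrr sub0r normrN normrZ ger0_norm// mulrC ler_wpM2l.
rewrite -(ler_pM2r t0) -{1}(ger0_norm (ltW t0)) -normrM -uE/=.
rewrite scale0r addr0 order3_eq0 subr0.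
have tb : `|t *: b| = t * `|b| by rewrite normrZ (ger0_norm (ltW t0)).
have /(near HW t _) : `|t *: b| <= `|b| * t by rewrite tb mulrC.
move=> /(_ _)/le_trans; apply; rewrite ?tb//.
have := mulr_ge0 C0 (exprn_ge0 3 (normr_ge0 b)).
set X := C * `|b| ^+ 3 => X0.
have -> : C * (t * `|b|) ^+ 3 = X * t * t * t by rewrite /X; ring.
(* The decay of W gives t^3 where t^2 is enough, so one factor t < 1 is discarded. *)
by rewrite ler_piMr ?(ltW t1)// mulr_ge0 ?mulr_ge0 ?(ltW t0).
Unshelve. all: by end_near. Qed.

(* The second difference of W along a and b equals D_a (D_b W) at a nearby
   point, by the mean value theorem twice; being O(t^3) it forces D_a (D_b W)
   to vanish at x without appeal to the symmetry of second derivatives. *)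
Lemma order3_derive2_eq0 a b : 'D_a ('D_b W) x = 0.
Proof.
(* The factor 4 counts the corners of the parallelogram spanned by t a and t b, each at distance at
   most (|a| + |b|) t from x. *)
apply: (@continuous_small_eq0 _ ('D_a ('D_b W)) x (C * (4 * (`|a| + `|b|) ^+ 3)) (`|a| + `|b|)).
  by apply: differentiable_continuous; exact: (@sW x I [:: a; b]).
have HW := near_norm_right (`|a| + `|b|) W3.
near=> t.
have t0 : 0 < t by near: t; exact: nbhs_right_gt.
have t1 : t < 1 by near: t; exact: nbhs_right_lt.
have [u /andP[u0 ut] uE] := mvt0 (ltW t0)
  (fun s => is_deriveB (@is_derive_line _ _ _ _ _ 0 (x + t *: a) b s sW I)
     (@is_derive_line _ _ _ _ _ 0 x b s sW I)).
have [v /andP[v0 vt] vE] := mvt0 (ltW t0)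
  (fun s => @is_derive_line _ _ _ _ _ 0 (x + u *: b) a s (smooth_on_derive b sW) I).
exists (x + u *: b + v *: a).
have nZ (w : R) (c : 'rV[R]_n) : 0 <= w -> w <= t -> `|w *: c| <= `|c| * t.
  by move=> w0 wt; rewrite normrZ ger0_norm// mulrC ler_wpM2l.
split.
  rewrite -addrA opprD addrA subrr sub0r normrN (le_trans (ler_normD _ _))//.
  by rewrite addrC mulrDl lerD// nZ.
have S4 : 'D_a ('D_b W) (x + u *: b + v *: a) * t * t =
    W (x + (t *: a + t *: b)) - W (x + t *: b) - (W (x + t *: a) - W x).
  rewrite -[X in X * t]/(iterD (nseq 1 a) ('D_b W) (x + u *: b + v *: a) * t).
  rewrite -vE /= scale0r addr0 (addrAC x) -[LHS]uE /= !fctE/= !scale0r !addr0.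
  by rewrite !addrA.
have W0 (z : 'rV[R]_n) : `|z| <= (`|a| + `|b|) * t ->
    `|W (x + z)| <= C * ((`|a| + `|b|) * t) ^+ 3.
  move=> zt; apply: le_trans (near HW t _ z zt) _ => //.
  apply: ler_wpM2l => //; apply: lerXn2r => //; rewrite nnegrE//.
  exact: le_trans (normr_ge0 _) zt.
have tt : t <= t by [].
have ta := nZ t a (ltW t0) tt; have tb := nZ t b (ltW t0) tt.
have ab0 : 0 <= (`|a| + `|b|) * t by rewrite mulr_ge0 ?addr_ge0// ltW.
rewrite -(ler_pM2r t0) -(ler_pM2r t0).
have -> : `|'D_a ('D_b W) (x + u *: b + v *: a)| * t * t =
    `|'D_a ('D_b W) (x + u *: b + v *: a) * t * t|.
  by rewrite !normrM (ger0_norm (ltW t0)).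
rewrite S4.
have H1 := W0 (t *: a + t *: b); have H2 := W0 (t *: b).
have H3 := W0 (t *: a); have := W0 0; rewrite addr0 normr0 => H4.
have {}H1 : `|W (x + (t *: a + t *: b))| <= C * ((`|a| + `|b|) * t) ^+ 3.
  by apply: H1; rewrite (le_trans (ler_normD _ _))// mulrDl lerD.
have {}H2 : `|W (x + t *: b)| <= C * ((`|a| + `|b|) * t) ^+ 3.
  by apply: H2; rewrite (le_trans tb)// ler_wpM2r ?(ltW t0)// lerDr.
have {}H3 : `|W (x + t *: a)| <= C * ((`|a| + `|b|) * t) ^+ 3.
  by apply: H3; rewrite (le_trans ta)// ler_wpM2r ?(ltW t0)// lerDl.
have {}H4 := H4 ab0.
apply: le_trans (ler_normB _ _) _.
apply: le_trans (lerD (ler_normB _ _) (ler_normB _ _)) _.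
apply: le_trans (lerD (lerD H1 H2) (lerD H3 H4)) _.
by rewrite le_eqVlt; apply/orP; left; apply/eqP; ring.
Unshelve. all: by end_near. Qed.
End Jets.
End Orders.

(** * Weighted homogeneity *)

(** Continuity at 0 kills the constant term; then c is divisible by X and the quotient satisfies the
    bound with r lowered by one. *)
Lemma horner_small_coef0 (R : realType) (c : {poly R}) (K : R) (r : nat) :
  (\forall t \near (0 : R)^'+, `|c.[t]| <= K * t ^+ r) ->
  forall j, (j < r)%N -> c`_j = 0.
Proof.
elim: r c => [//|r IH] c H.
have c0 : c`_0 = 0.
  rewrite -horner_coef0; apply/eqP/negP => /negP gx0.
  have e0 : 0 < `|c.[0]| / 2 by rewrite divr_gt0// normr_gt0.
  have /cvgrPdist_lt/(_ _ e0)/nbhs_ballP[d /= d0 Hd] := @continuous_horner R c 0.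
  near (0 : R)^'+ => t.
  have t0 : 0 < t by near: t; exact: nbhs_right_gt.
  have t1 : t < 1 by near: t; exact: nbhs_right_lt.
  have td : t < d by near: t; exact: nbhs_right_lt.
  have gt := near H t _.
  have {gt} : `|c.[t]| <= K * t ^+ r.+1 by exact: gt.
  have /Hd/= : ball 0 d t by rewrite -ball_normE/= sub0r normrN gtr0_norm.
  have : `|K| * t < `|c.[0]| / 2.
    have : t < (`|c.[0]| / 2) / (`|K| + 1).
      by near: t; apply: nbhs_right_lt; rewrite divr_gt0// ltr_wpDl.
    rewrite ltr_pdivlMr ?ltr_wpDl// => tM.
    by apply: le_lt_trans tM; rewrite mulrDr mulr1 mulrC lerDl ltW.
  have : K * t ^+ r.+1 <= `|K| * t.
    apply: (@le_trans _ _ (`|K| * t ^+ r.+1)).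
      by rewrite ler_wpM2r ?exprn_ge0 ?ler_norm// ltW.
    by rewrite ler_wpM2l// exprS ler_piMr ?(ltW t0)// exprn_ile1 ?(ltW t0) ?(ltW t1).
  have := lerB_dist c.[0] c.[t].
  by lra.
case/factor_theorem: (introT rootP (etrans (horner_coef0 c) c0)) => c'.
rewrite subr0 => cE; case=> [//|j] jr.
rewrite cE coefMX/=; apply: IH => //.
near=> t.
have t0 : 0 < t by near: t; exact: nbhs_right_gt.
rewrite -(ler_pM2r t0) -mulrA -exprSr.
have -> : `|c'.[t]| * t = `|c.[t]| by rewrite cE hornerMX normrM (gtr0_norm t0).
by near: t.
Unshelve. all: by end_near. Qed.

Section Homogeneity.
Context {R : realType}.

Lemma iterD_nseqZ (n j : nat) (A : set 'rV[R]_n) (h : 'rV[R]_n -> R) x z t :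
  open A -> smooth_on A h -> A x ->
  iterD (nseq j (t *: z)) h x = t ^+ j * iterD (nseq j z) h x.
Proof.
move=> oA sh Ax; elim: j h sh => [|j IH] h sh; first by rewrite expr0 mul1r.
rewrite !(iterD_nseq_coords _ _ oA)// mulr_sumr; apply: eq_bigr => i _.
rewrite IH; last exact: smooth_on_derive.
by rewrite mxE exprS; ring.
Qed.

(** The degree for the grading in which the variable j has degree [D j]. With [D j] the scaling
    exponent of p_j - p_j(0), it is the power of t by which the monomial in P(x) - P(0) scales when
    x becomes t x. *)
Definition weight l (D : 'I_l -> nat) (m : mpoly.multinom l) : nat :=
  (\sum_j m j * D j)%N.

Definition monomial_at l (z : 'rV[R]_l) (m : mpoly.multinom l) : R :=
  \prod_j z 0 j ^+ m j.

Lemma monomial_at_scale l (D : 'I_l -> nat) (z : 'rV[R]_l) m (t : R) :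
  monomial_at (\row_j (t ^+ D j * z 0 j)) m = t ^+ weight D m * monomial_at z m.
Proof.
rewrite /monomial_at /weight -prodrXr -big_split/=.
by apply: eq_bigr => j _; rewrite mxE exprMn -exprM mulnC.
Qed.

Lemma peval_monomials l (q : mpoly l R) z :
  peval q z = \sum_(m <- msupp q) mcoeff m q * monomial_at z m.
Proof. by rewrite /peval mevalE. Qed.

Lemma norm_monomial_at l (z : 'rV[R]_l) m : `|monomial_at z m| <= `|z| ^+ mdeg m.
Proof.
rewrite mdegE normr_prod -prodrXr; apply: ler_prod => j _.
by rewrite normr_ge0/= normrX lerXn2r// ?nnegrE// normr_entry.
Qed.

Lemma homogeneous_scale d (q : mpoly d R) : homogeneous q ->
  exists e : nat, forall t x, peval q (t *: x) = t ^+ e * peval q x.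
Proof.
move=> [e /dhomogP qe]; exists e => t x.
rewrite !peval_monomials mulr_sumr; apply: eq_big_seq => m /qe mq.
rewrite -[t *: x]/(t *: x) (_ : t *: x = \row_j (t ^+ 1 * x 0 j)).
  rewrite (monomial_at_scale (fun=> 1%N)) /weight.
  under eq_bigr do rewrite muln1.
  have -> : (\sum_j m j)%N = e by rewrite -mq -mdegE.
  by rewrite mulrCA.
by apply/rowP => j; rewrite !mxE expr1.
Qed.

(** Positivity of the exponent is what later makes P(t x) - P(0) of size O(t). In degree 0 both
    differences vanish, so the exponent 1 serves; in positive degree q vanishes at 0. *)
Lemma homogeneous_scale0 d (q : mpoly d R) : homogeneous q ->
  exists2 e : nat, (0 < e)%N & forall t x,
    peval q (t *: x) - peval q 0 = t ^+ e * (peval q x - peval q 0).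
Proof.
move=> /homogeneous_scale[[|e] qe].
  exists 1%N => // t x; have := qe 0 x; rewrite scale0r expr0 mul1r => ->.
  by rewrite qe mul1r subrr mulr0.
exists e.+1 => // t x; have := qe 0 0; rewrite scale0r exprS !mul0r => ->.
by rewrite !subr0 qe.
Qed.
End Homogeneity.

(** * Truncation of the section *)

Section TaylorPolynomials.
Context {R : realType}.

Lemma iterD_entry n m (H : 'rV[R]_n -> 'rV[R]_m) i vs :
  smooth_on setT H ->
  iterD vs (fun y => H y 0 i) = (fun y => iterD vs H y 0 i).
Proof.
move=> sH; elim: vs => [//|v vs IH] /=; apply/funext => y.
by rewrite derive_entry ?IH//; exact: sH.
Qed.

Lemma smooth_on_entry n m (H : 'rV[R]_n -> 'rV[R]_m) i :
  smooth_on setT H -> smooth_on setT (fun y => H y 0 i).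
Proof.
by move=> sH y _ vs; rewrite iterD_entry//; apply: differentiable_entry; exact: sH.
Qed.

Lemma taylor_polynomial n s (A : set 'rV[R]_n) (h : 'rV[R]_n -> R) x :
  open A -> smooth_on A h -> A x ->
  exists (q : mpoly n R) (C : R), 0 <= C /\ \forall z \near (0 : 'rV[R]_n),
    `|h (x + z) - peval q z| <= C * `|z| ^+ s.+1.
Proof.
move=> oA sh Ax; have [C C0 HC] := taylor_remainder s oA sh Ax.
have /(_ _)/cid-/all_sig[q qE] := fun j : nat => iterD_nseq_poly j oA sh Ax.
exists (\sum_(j < s.+1) mpolyC n (j`!%:R)^-1 * q j), C; split=> //.
apply: filterS HC => z; congr (`|_ - _| <= _).
rewrite /peval raddf_sum/=; apply: eq_bigr => j _.
by rewrite mevalM mevalC qE.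
Qed.

(** For |z| < 1 the discarded monomials, of degree at least 3, and the Taylor error, of order r + 1
    >= 3, are both O(|z|^3). *)
Lemma truncation_order3 n r (h : 'rV[R]_n -> R) x (q : mpoly n R) (C : R)
    (P : pred (mpoly.multinom n)) : (2 <= r)%N -> 0 <= C ->
  (\forall z \near (0 : 'rV[R]_n),
    `|h (x + z) - peval q z| <= C * `|z| ^+ r.+1) ->
  (forall m, ~~ P m -> (2 < mdeg m)%N) ->
  exists2 C' : R, 0 <= C' & \forall z \near (0 : 'rV[R]_n),
    `|h (x + z) - \sum_(m <- msupp q | P m) mcoeff m q * monomial_at z m|
      <= C' * `|z| ^+ 3.
Proof.
move=> r2 C0 HC P3.
exists (C + \sum_(m <- msupp q | ~~ P m) `|mcoeff m q|).
  by rewrite addr_ge0// sumr_ge0.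
have z1 : \forall z \near (0 : 'rV[R]_n), `|z| < 1.
  apply/nbhs_ballP; exists 1 => //= z.
  by rewrite -ball_normE/= sub0r normrN.
have zX (z : 'rV[R]_n) j : `|z| < 1 -> (2 < j)%N -> `|z| ^+ j <= `|z| ^+ 3.
  by move=> zl1 j2; rewrite ler_wiXn2l// ltW.
apply: filterS2 HC z1 => z HC zl1.
rewrite mulrDl; set S := \sum_(m <- msupp q | P m) _.
rewrite (_ : h (x + z) - S = (h (x + z) - peval q z) + (peval q z - S)); last by ring.
rewrite (le_trans (ler_normD _ _))// lerD//.
  by rewrite (le_trans HC)// ler_wpM2l// zX.
rewrite peval_monomials (bigID P)/= -/S [S + _]addrC addrK.
rewrite (le_trans (ler_norm_sum _ _ _))// mulr_suml.
apply: ler_sum => m /P3 m3; rewrite normrM ler_wpM2l//.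
by rewrite (le_trans (norm_monomial_at _ _))// zX.
Qed.

End TaylorPolynomials.

(** The left side is the value at 1 of the truncation at degree r. It lets a cut by weight be read
    as a cut by degree in one variable t. *)
Lemma coef_sum_scaleXn (R : realType) (I : Type) (s : seq I) (c : I -> R)
    (e : I -> nat) (r : nat) :
  \sum_(j < r.+1) (\sum_(i <- s) c i *: 'X^(e i))`_j =
  \sum_(i <- s | (e i <= r)%N) c i.
Proof.
under eq_bigr do rewrite coef_sum; rewrite exchange_big/= [RHS]big_mkcond/=.
apply: eq_bigr => i _; under eq_bigr do rewrite coefZ coefXn.
case: leqP => ei.
  rewrite (bigD1 (inord (e i)))//= inordK// eqxx mulr1 big1 ?addr0// => j ji.
  have -> : (j == e i :> nat) = false.
    by apply: contraNF ji => /eqP <-; rewrite inord_val.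
  by rewrite mulr0.
rewrite big1// => j _; have -> : (j == e i :> nat) = false.
  by apply/negbTE; rewrite neq_ltn (leq_trans (ltn_ord j) ei).
by rewrite mulr0.
Qed.

Section Truncation.
Context {R : realType} {d l k : nat}.
Variables (p : l.-tuple (mpoly d R)) (F : k.-tuple (mpoly d R)).
Variables (D : 'I_l -> nat) (e : 'I_k -> nat).
Hypothesis D0 : forall j, (0 < D j)%N.
Hypothesis pD : forall j t x,
  peval (tnth p j) (t *: x) - peval (tnth p j) 0 =
  t ^+ D j * (peval (tnth p j) x - peval (tnth p j) 0).
Hypothesis Fe : forall i t x,
  peval (tnth F i) (t *: x) = t ^+ e i * peval (tnth F i) x.

Local Notation P := (orbit_map p).

Lemma orbit_map_scale t x :
  P (t *: x) - P 0 = \row_j (t ^+ D j * (P x - P 0) 0 j).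
Proof. by apply/rowP => j; rewrite !mxE pD. Qed.

(** The cut depends on i because it measures the scaling degree in x of the whole product with
    F_i. *)
Definition weighted_truncation r (q : 'I_k -> mpoly l R) (y : 'rV[R]_l) :
    'rV[R]_k :=
  \row_i \sum_(m <- msupp (q i) | (weight D m + e i <= r)%N)
    mcoeff m (q i) * monomial_at (y - P 0) m.

Lemma weighted_truncation_polymap r q : polymap (weighted_truncation r q).
Proof.
move=> i; under eq_fun do rewrite mxE.
apply: polyfun_sum => m; apply: polyfunM; first exact: polyfun_cst.
apply: polyfun_prod => j; apply: polyfunX.
under eq_fun do rewrite !mxE.
by apply: polyfunD; [exact: polyfun_coord|exact: polyfun_cst].
Qed.

Lemma taylor0_weighted_truncation r (q : 'I_k -> mpoly l R) (C : R)
    (H : 'rV[R]_l -> 'rV[R]_k) (f : 'rV[R]_d -> R) (A : set 'rV[R]_d) :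
  open_nbhs (0 : 'rV[R]_d) A -> smooth_on A f ->
  (\forall x \near (0 : 'rV[R]_d),
     f x = \sum_(i < k) H (P x) 0 i * peval (tnth F i) x) ->
  0 <= C ->
  (forall i, \forall z \near (0 : 'rV[R]_l),
    `|H (P 0 + z) 0 i - peval (q i) z| <= C * `|z| ^+ r.+1) ->
  forall x, taylor0 r f x =
    \sum_(i < k) weighted_truncation r q (P x) 0 i * peval (tnth F i) x.
Proof.
move=> [oA A0] sf fE C0 HC x.
set z := P x - P 0.
(* Both polynomials in t live on the line through x: [a.[t]] is the Taylor polynomial of f at t x,
   and [b.[t]] is the sum of the products of q_i(P(t x) - P(0)) with F_i(t x), not yet truncated.
   Adding their coefficients up to degree r gives the two sides of the goal, so equality of these
   coefficients suffices. *)
pose a : {poly R} := \sum_(j < r.+1) ((j`!%:R)^-1 * iterD (nseq j x) f 0) *: 'X^j.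
pose b : {poly R} := \sum_(i < k) \sum_(m <- msupp (q i))
   (mcoeff m (q i) * monomial_at z m * peval (tnth F i) x) *: 'X^(weight D m + e i).
have aE : taylor0 r f x = \sum_(j < r.+1) a`_j.
  rewrite [RHS](coef_sum_scaleXn _ _ (fun j : 'I_r.+1 => j : nat)) /taylor0.
  by apply: eq_big => // j; rewrite -ltnS ltn_ord.
have bE : \sum_(i < k) weighted_truncation r q (P x) 0 i * peval (tnth F i) x =
    \sum_(j < r.+1) b`_j.
  under [RHS]eq_bigr do rewrite coef_sum.
  rewrite exchange_big/=; apply: eq_bigr => i _.
  by rewrite (coef_sum_scaleXn _ _ (fun m => weight D m + e i)%N) mxE mulr_suml.
rewrite aE bE; apply: eq_bigr => j _; apply/eqP; rewrite -subr_eq0 -coefB; apply/eqP.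
have [Cf Cf0 HCf] := taylor_remainder r oA sf A0.
(* The first summand bounds the Taylor error of f, the second the errors made in replacing each
   component of H by q_i. *)
set K := Cf * `|x| ^+ r.+1 + \sum_(i < k) C * `|z| ^+ r.+1 * `|peval (tnth F i) x|.
apply: (@horner_small_coef0 _ _ K r.+1); last exact: ltn_ord.
have H1 := near_norm_right `|x| fE.
have H2 := near_norm_right `|x| HCf.
have H3 : \forall t \near (0 : R)^'+, forall (i : 'I_k) w, `|w| <= `|z| * t ->
    `|H (P 0 + w) 0 i - peval (q i) w| <= C * `|w| ^+ r.+1.
  exact: (@filter_forall _ _ (fun (i : 'I_k) t => forall w, `|w| <= `|z| * t ->
    `|H (P 0 + w) 0 i - peval (q i) w| <= C * `|w| ^+ r.+1) _ _
    (fun i => near_norm_right `|z| (HC i))).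
near=> t.
have t0 : 0 < t by near: t; exact: nbhs_right_gt.
have t1 : t < 1 by near: t; exact: nbhs_right_lt.
have tx : `|t *: x| <= `|x| * t by rewrite normrZ gtr0_norm// mulrC.
have fx : f (t *: x) = \sum_(i < k) H (P (t *: x)) 0 i * peval (tnth F i) (t *: x).
  exact: (near H1 t _ (t *: x) tx).
have tr : 0 <= t ^+ r.+1 by rewrite exprn_ge0// ltW.
have ax : `|a.[t] - f (t *: x)| <= Cf * `|x| ^+ r.+1 * t ^+ r.+1.
  have H2t : `|f (0 + t *: x) - \sum_(j < r.+1) j`!%:R^-1 * iterD (nseq j (t *: x)) f 0|
      <= Cf * `|t *: x| ^+ r.+1 by exact: (near H2 t _ (t *: x) tx).
  rewrite distrC; move: H2t; rewrite add0r normrZ (gtr0_norm t0) exprMn.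
  rewrite -mulrA [t ^+ _ * _]mulrC; congr (`|_ - _| <= _).
  rewrite horner_sum; apply: eq_bigr => i _.
  by rewrite hornerZ hornerXn (iterD_nseqZ _ _ _ oA)// -mulrA [_ ^+ _ * _]mulrC.
set w := P (t *: x) - P 0.
have wE : w = \row_j (t ^+ D j * z 0 j) by exact: orbit_map_scale.
have wt : `|w| <= `|z| * t.
  rewrite [leLHS]/Num.Def.normr/= mx_normrE; apply: bigmax_le => [|[i0 s] _ /=].
    by rewrite mulr_ge0// ltW.
  rewrite ord1 wE mxE normrM mulrC ler_pM//; first exact: normr_entry.
  (* Since [D s] is positive and t < 1, the power t^(D s) is at most t. *)
  rewrite normrX gtr0_norm// -(prednK (D0 s)) exprS ler_piMr ?(ltW t0)//.
  by rewrite exprn_ile1 ?(ltW t0) ?(ltW t1).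
have bt : b.[t] = \sum_(i < k) peval (q i) w * peval (tnth F i) (t *: x).
  rewrite horner_sum; apply: eq_bigr => i _.
  rewrite horner_sum (peval_monomials (q i) w) mulr_suml; apply: eq_bigr => m _.
  by rewrite hornerZ hornerXn wE monomial_at_scale Fe exprD; ring.
have bx : `|f (t *: x) - b.[t]| <=
    (\sum_(i < k) C * `|z| ^+ r.+1 * `|peval (tnth F i) x|) * t ^+ r.+1.
  rewrite fx bt -sumrB mulr_suml (le_trans (ler_norm_sum _ _ _))//.
  apply: ler_sum => i _; rewrite -mulrBl normrM.
  have H3t : `|H (P 0 + w) 0 i - peval (q i) w| <= C * `|w| ^+ r.+1.
    exact: (near H3 t _ i w wt).
  have -> : P (t *: x) = P 0 + w by rewrite /w addrC subrK.
  rewrite mulrAC ler_pM//.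
    rewrite (le_trans H3t)// -mulrA ler_wpM2l// -exprMn lerXn2r// nnegrE//.
    by rewrite mulr_ge0// ltW.
  rewrite Fe normrM normrX gtr0_norm// ler_piMl//.
  by rewrite exprn_ile1 ?(ltW t0) ?(ltW t1).
rewrite hornerD hornerN /K mulrDl.
rewrite (_ : a.[t] - b.[t] = (a.[t] - f (t *: x)) + (f (t *: x) - b.[t])); last by ring.
by rewrite (le_trans (ler_normD _ _))// lerD.
Unshelve. all: by end_near. Qed.
End Truncation.

Lemma sum_nat_ge (I : finType) (g : I -> nat) i : (g i <= \sum_j g j)%N.
Proof. by rewrite (bigD1 i)//= leq_addr. Qed.

Lemma taylor0_decomposition (R : realType) (d l k : nat)
    (p : l.-tuple (mpoly d R)) (F : k.-tuple (mpoly d R))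
    (H : 'rV[R]_l -> 'rV[R]_k) (f : 'rV[R]_d -> R) :
  (forall j, homogeneous (tnth p j)) -> (forall i, homogeneous (tnth F i)) ->
  smooth_near 0 f -> smooth_on setT H ->
  (\forall x \near (0 : 'rV[R]_d),
     f x = \sum_(i < k) H (orbit_map p x) 0 i * peval (tnth F i) x) ->
  exists (r : nat) (H' : 'rV[R]_l -> 'rV[R]_k) (C : 'I_k -> R),
    [/\ polymap H', (forall i, 0 <= C i),
        (forall x, taylor0 r f x =
           \sum_(i < k) H' (orbit_map p x) 0 i * peval (tnth F i) x) &
        forall i, \forall z \near (0 : 'rV[R]_l),
          `|H (orbit_map p 0 + z) 0 i - H' (orbit_map p 0 + z) 0 i|
            <= C i * `|z| ^+ 3].
Proof.
move=> hp hF [A oA sf] sH fE.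
have /(_ _)/cid2-/all_sig2[D D0 pD] := fun j => homogeneous_scale0 (hp j).
have /(_ _)/cid-/all_sig[e Fe] := fun i => homogeneous_scale (hF i).
(* The sums bound all the degrees at once, and the last 2 ensures r >= 2, which makes the Taylor
   error of H at least cubic. *)
pose r := (2 * (\sum_j D j) + (\sum_i e i) + 2)%N.
have := fun i => taylor_polynomial r openT (smooth_on_entry i sH)
  (I : [set: 'rV[R]_l] (orbit_map p 0)).
move=> /(_ _)/cid-/all_sig[q qE].
have {qE}/(_ _)/cid-/all_sig[C CE] := qE.
have C0 i : 0 <= C i by case: (CE i).
have HC i := (CE i).2.
have HS i : \forall z \near (0 : 'rV[R]_l),
    `|H (orbit_map p 0 + z) 0 i - peval (q i) z| <= (\sum_i C i) * `|z| ^+ r.+1.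
  apply: filterS (HC i) => z /le_trans; apply; rewrite ler_wpM2r ?exprn_ge0//.
  by rewrite (bigD1 i)//= lerDl sumr_ge0.
have P3 i m : ~~ (weight D m + e i <= r)%N -> (2 < mdeg m)%N.
  rewrite ltnNge; apply: contraNN => m2.
  rewrite /r -addnA leq_add//.
    apply: (@leq_trans (mdeg m * \sum_j D j)%N); last by rewrite leq_mul2r m2 orbT.
    rewrite /weight mdegE big_distrl/=; apply: leq_sum => j _.
    by rewrite leq_mul2l sum_nat_ge orbT.
  by rewrite (leq_trans (sum_nat_ge e i))// leq_addr.
have r2 : (2 <= r)%N by rewrite /r leq_addl.
have := fun i => @truncation_order3 _ _ _ (fun y => H y 0 i) (orbit_map p 0)
  _ _ _ r2 (C0 i) (HC i) (P3 i).
move=> /(_ _)/cid2-/all_sig2[C' C'0 HC'].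
exists r, (weighted_truncation p D e r q), C'; split => //.
- exact: weighted_truncation_polymap.
- apply: (taylor0_weighted_truncation D0 pD Fe oA sf fE _ HS).
  exact: sumr_ge0.
- move=> i; apply: filterS (HC' i) => z.
  by rewrite mxE [orbit_map p 0 + z]addrC addrK.
Qed.

(** * Orthonormal frames and sequences of matrices *)

Section LinearAlgebra.
Context {R : realType}.

Lemma dot_self_gt0 N (u : 'rV[R]_N) : u != 0 -> 0 < (u *m u^T) 0 0.
Proof.
move=> u0; rewrite mxE lt_neqAle; apply/andP; split; last first.
  by apply: sumr_ge0 => j _; rewrite mxE -expr2 sqr_ge0.
apply: contraNN u0; rewrite eq_sym psumr_eq0; last first.
  by move=> j _; rewrite mxE -expr2 sqr_ge0.
move=> /allP u0; apply/eqP/rowP => j; rewrite mxE.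
have := u0 j; rewrite mem_index_enum => /(_ isT)/=.
by rewrite mxE mulf_eq0 orbb => /eqP.
Qed.

Lemma normalize N (u : 'rV[R]_N) : u != 0 ->
  exists2 a : R, a != 0 & (a *: u) *m (a *: u)^T = 1%:M.
Proof.
move=> /dot_self_gt0; set s := (u *m u^T) 0 0 => s0.
exists (Num.sqrt s)^-1; first by rewrite invr_neq0// gt_eqF// sqrtr_gt0.
apply/matrixP => i j; rewrite !ord1 linearZ/= -scalemxAl -scalemxAr scalerA !mxE/= -/s.
have -> : \sum_j0 u 0 j0 * u^T j0 0 = s by rewrite /s mxE.
by rewrite -expr2 exprVn sqr_sqrtr ?ltW// mulVf// gt_eqF.
Qed.

(** Gram-Schmidt. Orthonormal frames have bounded entries, so sequences of them have convergent
    subsequences, and the limits are again frames of the same rank. *)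
Lemma orthonormal_basis N m (b : 'M[R]_(m, N)) : row_free b ->
  exists2 c : 'M[R]_(m, N), (c :=: b)%MS & c *m c^T = 1%:M.
Proof.
elim: m b => [|m IH] b bf.
  by exists b => //; apply/matrixP => -[].
rewrite -[m.+1]/(1 + m)%N in b bf *.
set b1 := usubmx b; set b2 := dsubmx b.
have bE : b = col_mx b1 b2 by rewrite vsubmxK.
have b2f : row_free b2.
  rewrite -row_leq_rank -(leq_add2l 1).
  have := bf; rewrite -row_leq_rank bE => /leq_trans; apply.
  rewrite -addsmxE (leq_trans (mxrank_adds_leqif _ _))// leq_add2r rank_leq_row//.
have [c2 c2E c2o] := IH b2 b2f.
pose v := b1 - b1 *m c2^T *m c2.
have vc2 : v *m c2^T = 0 by rewrite /v mulmxBl -[_ *m c2 *m c2^T]mulmxA c2o mulmx1 subrr.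
have vb : (col_mx v c2 :=: b)%MS.
  rewrite bE; apply/eqmxP/andP; split; rewrite -!addsmxE !addsmx_sub.
    apply/andP; split; last by rewrite c2E addsmxSr.
    rewrite addmx_sub ?addsmxSl// eqmx_opp (submx_trans (submxMl _ _))//.
    by rewrite c2E addsmxSr.
  apply/andP; split; last by rewrite -c2E addsmxSr.
  rewrite -[X in (X <= _)%MS](subrK (b1 *m c2^T *m c2)) -/v addmx_sub ?addsmxSl//.
  by rewrite (submx_trans (submxMl _ _))// addsmxSr.
have v0 : v != 0.
  apply: contraTN bf => /eqP v0; rewrite -row_leq_rank -vb v0 -ltnNge.
  rewrite -addsmxE (leq_ltn_trans (mxrank_adds_leqif _ _))// mxrank0 add0n.
  by rewrite ltnS rank_leq_row.
have [a a0 ao] := normalize v0.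
exists (col_mx (a *: v) c2).
  apply: eqmx_trans vb; apply/eqmxP; rewrite -!addsmxE.
  by apply/andP; split; rewrite addsmxS// eqmx_scale.
rewrite tr_col_mx mul_col_row ao c2o.
rewrite -scalemxAl vc2 scaler0 linearZ/= -scalemxAr -[c2 *m v^T]trmxK trmx_mul trmxK vc2.
by rewrite trmx0 scaler0 -scalar_mx_block.
Qed.

Lemma orthonormal_row_free N m (c : 'M[R]_(m, N)) :
  c *m c^T = 1%:M -> row_free c.
Proof. by move=> cc; apply/row_freeP; exists c^T. Qed.

Lemma orthonormal_entry N m (c : 'M[R]_(m, N)) i j :
  c *m c^T = 1%:M -> `|c i j| <= 1.
Proof.
move=> /matrixP/(_ i i); rewrite !mxE eqxx mulr1n (bigD1 j)//= mxE -expr2 => cE.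
rewrite -(expr_le1 (n := 2))// ?normr_ge0// -normrX ger0_norm ?sqr_ge0// -[leRHS]cE lerDl.
by apply: sumr_ge0 => j0 _; rewrite mxE -expr2 sqr_ge0.
Qed.

(** If the image of L and the rows of b fail to span, the stacked matrix is not of full column rank,
    and a normalized kernel vector is orthogonal to both. These are closed equations, unlike the
    failure to span. *)
Lemma covector N n m (L : {linear 'rV[R]_n -> 'rV[R]_N}) (b : 'M[R]_(m, N)) :
  ~ (forall w, exists v t, (t <= b)%MS /\ w = L v + t) ->
  exists xi : 'rV[R]_N, [/\ xi *m xi^T = 1%:M,
    forall v, L v *m xi^T = 0 & b *m xi^T = 0].
Proof.
move=> nt; pose S := col_mx (lin1_mx L) b.
have [Sf|Snf] := boolP (row_full S).
  exfalso; apply: nt => w; have /submxP[u ->] := submx_full w Sf.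
  exists (lsubmx u), (rsubmx u *m b); rewrite submxMl; split => //.
  by rewrite -[u in LHS]hsubmxK mul_row_col mul_rV_lin1.
have kn0 : kermx S^T != 0.
  by rewrite kermx_eq0 -row_leq_rank mxrank_tr -ltnNge; move: Snf; rewrite -col_leq_rank -ltnNge.
have nz0 : nz_row (kermx S^T) != 0 by rewrite nz_row_eq0.
set u := nz_row _ in nz0.
have uS : S *m u^T = 0.
  rewrite -[S]trmxK -trmx_mul; apply/eqP; rewrite trmx_eq0; apply/eqP.
  by apply/sub_kermxP; exact: nz_row_sub.
move: uS; rewrite mul_col_mx => /eqP; rewrite col_mx_eq0 => /andP[/eqP uL /eqP ub].
have [a a0 ao] := normalize nz0.
exists (a *: u); split => // [v|]; rewrite linearZ/= -scalemxAr.
  by rewrite -(mul_rV_lin1 L v) -mulmxA uL mulmx0 scaler0.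
by rewrite ub scaler0.
Qed.

End LinearAlgebra.

(** * Compactness and limits for sequences of matrices *)

Section Sequences.
Context {R : realType}.

Lemma cvg_mxP m n (c : nat -> 'M[R]_(m, n)) (l : 'M[R]_(m, n)) :
  (forall i j, (fun t => c t i j) @ \oo --> l i j) <-> c @ \oo --> l.
Proof.
split=> [H|H i j]; last first.
  have cc : (fun N : 'M[R]_(m, n) => N i j) @ l --> l i j by exact: coord_continuous.
  exact: (cvg_comp _ _ H cc).
apply/cvgrPdist_le => e e0; near=> t.
rewrite /Num.Def.normr/= mx_normrE (bigmax_le _ (ltW e0))//= => i _.
rewrite !mxE/=; move: i; near: t; apply: filter_forall => /= i.
exact: ((cvgrPdist_le _ _).1 (H i.1 i.2)).
Unshelve. all: by end_near. Qed.

Lemma increasing_seq_ge (f : nat -> nat) : increasing_seq f -> forall n, (n <= f n)%N.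
Proof.
move=> fi; elim=> [//|n IH]; apply: leq_ltn_trans IH _.
by move/increasing_seqP : fi; exact.
Qed.

Lemma increasing_seq_cvg (f : nat -> nat) : increasing_seq f -> f @ \oo --> \oo.
Proof.
move=> /increasing_seq_ge fn A [N _ NA]; exists N => // n /= Nn.
by apply: NA; exact: leq_trans Nn (fn n).
Qed.

Lemma increasing_seq_comp (f g : nat -> nat) :
  increasing_seq f -> increasing_seq g -> increasing_seq (f \o g).
Proof. by move=> fi gi a b; rewrite /= fi; exact: gi. Qed.

Lemma cvg_subseq (T : topologicalType) (u : nat -> T) (l : T) f :
  increasing_seq f -> u @ \oo --> l -> (u \o f) @ \oo --> l.
Proof. by move=> /increasing_seq_cvg fi ul; apply: cvg_comp ul. Qed.

Lemma mx_bolzano m n (c : nat -> 'M[R]_(m, n)) :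
  (forall t i j, `|c t i j| <= 1) ->
  exists2 f : nat -> nat, increasing_seq f & exists l : 'M[R]_(m, n), (c \o f) @ \oo --> l.
Proof.
move=> c1.
have [f fi fc] : exists2 f : nat -> nat, increasing_seq f &
    forall ij, ij \in enum {: 'I_m * 'I_n} ->
      cvgn (fun t => c (f t) ij.1 ij.2).
  (* Subsequences are extracted one matrix entry at a time; the entries already treated keep
     converging along any further subsequence. *)
  elim: (enum _) => [|ij s [f fi fs]]; first by exists id.
  have [|g gi gc] := @bolzano_weierstrass R (fun t => c (f t) ij.1 ij.2).
    by exists 1; split => // M M1 t _; exact: le_trans (c1 _ _ _) (ltW M1).
  exists (f \o g); first exact: increasing_seq_comp.
  move=> ij'; rewrite inE => /predU1P[->//|/fs ijs].
  apply/cvg_ex; exists (lim ((fun t => c (f t) ij'.1 ij'.2) @ \oo)).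
  exact: (cvg_subseq gi ijs).
exists f => //; exists (\matrix_(i, j) lim ((fun t => c (f t) i j) @ \oo)).
apply/cvg_mxP => i j; rewrite mxE.
by apply: (fc (i, j)); rewrite mem_enum.
Qed.

Lemma cvg_mulmx m n q (a : nat -> 'M[R]_(m, n)) (b : nat -> 'M[R]_(n, q))
    (a0 : 'M[R]_(m, n)) (b0 : 'M[R]_(n, q)) :
  a @ \oo --> a0 -> b @ \oo --> b0 ->
  (fun t => a t *m b t) @ \oo --> a0 *m b0.
Proof.
move=> /cvg_mxP ca /cvg_mxP cb; apply/cvg_mxP => i j.
rewrite mxE; under eq_fun do rewrite mxE.
apply: cvg_big => [|s _]; first exact: add_continuous.
by apply: cvgM.
Qed.

Lemma cvg_trmx m n (a : nat -> 'M[R]_(m, n)) (a0 : 'M[R]_(m, n)) :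
  a @ \oo --> a0 -> (fun t => (a t)^T) @ \oo --> a0^T.
Proof.
move=> /cvg_mxP ca; apply/cvg_mxP => i j; rewrite mxE.
under eq_fun do rewrite mxE; exact: ca.
Qed.

Lemma cvg_near_cst_eq m n (a : nat -> 'M[R]_(m, n)) (a0 l : 'M[R]_(m, n)) :
  (\forall t \near \oo, a t = l) -> a @ \oo --> a0 -> a0 = l.
Proof.
move=> al /cvg_mxP ca; apply/matrixP => i j.
apply: (cvg_unique (@Rhausdorff R) (ca i j)).
by apply: cvg_near_cst; apply: filterS al => t ->.
Qed.
End Sequences.

(** * Tangent spaces of submanifolds *)

Section Tangent.
Context {R : realType}.

Lemma near_eq_differentiable_line (V : normedModType R) (f g : R -> V) t :
  (\forall s \near t, f s = g s) -> differentiable f t -> differentiable g t.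
Proof.
by move=> fg /derivable1_diffP df; apply/derivable1_diffP; exact: near_eq_derivable df.
Qed.

Lemma smooth_near_line n (V : normedModType R) (B : set 'rV[R]_n)
    (psi : 'rV[R]_n -> V) a w :
  open B -> smooth_on B psi -> B a ->
  smooth_near (0 : R) (fun t : R => psi (a + t *: w)).
Proof.
move=> oB sB Ba; pose C := (fun t : R => a + t *: w) @^-1` B.
have lc : continuous (fun t : R => a + t *: w).
  by move=> t; apply: cvgD; [exact: cvg_cst|exact: scalel_continuous].
have oC : open C by apply: open_comp => // t _; exact: lc.
have dl vs (t : R) : C t ->
    differentiable (fun t : R => iterD vs psi (a + t *: w)) t.
  move=> Ct; apply: (@differentiable_comp _ _ _ _ (fun t : R => a + t *: w) (iterD vs psi)).
    by apply: differentiableD => //; exact: differentiable_cst.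
  exact: sB.
(* Directions on the real line are arbitrary scalars, so each derivative contributes its scalar as a
   factor and one derivative of psi along w. *)
have iterE vs (t : R) : C t -> iterD vs (fun t : R => psi (a + t *: w)) t =
    (\prod_(v <- vs) v) *: iterD (nseq (size vs) w) psi (a + t *: w).
  elim: vs t => [|v vs IH] t Ct /=; first by rewrite big_nil scale1r.
  rewrite (derive_eq_on _ oC IH Ct).
  have dv : derivable (fun t : R => iterD (nseq (size vs) w) psi (a + t *: w)) t v.
    exact/diff_derivable/dl.
  rewrite [LHS](deriveZ _ dv) big_cons mulrC -scalerA; congr (_ *: _).
  rewrite deriveE ?deriv1E ?derive1E; [|exact/diff_derivable/dl|exact: dl].
  congr (_ *: _).
  by case: (is_derive_line (size vs) sB Ct).
exists C; first by split => //; rewrite /C/= scale0r addr0.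
move=> t Ct vs.
apply: (@near_eq_differentiable_line _ (fun t =>
   (\prod_(v <- vs) v) *: iterD (nseq (size vs) w) psi (a + t *: w))).
  by apply: filterS (open_nbhs_nbhs (conj oC Ct)) => s Cs; rewrite iterE.
exact: (differentiableZ _ (dl (nseq (size vs) w) t Ct)).
Qed.

Lemma diff_local_inverse n (f g : 'rV[R]_n -> 'rV[R]_n) x v :
  differentiable f x -> differentiable g (f x) ->
  (\forall y \near x, g (f y) = y) -> 'd g (f x) ('d f x v) = v.
Proof.
move=> df dg gf; rewrite -[LHS]/(('d g (f x) \o 'd f x) v) -diff_comp//.
rewrite -deriveE; last exact: differentiable_comp.
by rewrite (near_eq_derive (g := id))// derive_id.
Qed.

Lemma pid_mx_sub N m (w : 'rV[R]_N) : (m <= N)%N ->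
  (w <= (pid_mx m : 'M[R]_(m, N)))%MS <-> (forall i : 'I_N, (m <= i)%N -> w 0 i = 0).
Proof.
move=> mN; split=> [/submxP[u ->] i mi|w0].
  rewrite mxE big1// => j _; rewrite mxE.
  case: eqP => [ji|]; last by rewrite mulr0.
  by move: mi; rewrite -ji leqNgt ltn_ord.
apply/submxP; exists (w *m (pid_mx m : 'M[R]_(N, m))).
rewrite -mulmxA mul_pid_mx !minnn; apply/rowP => i; rewrite mxE.
rewrite (bigD1 i)//= mxE eqxx/= big1 ?addr0 => [|j ji]; last first.
  by rewrite mxE -val_eqE/= in ji *; rewrite (negbTE ji) mulr0.
by case: (ltnP i m) => [im|mi]; rewrite ?mulr1 ?mulr0// w0.
Qed.

Section Chart.
Variables (N m : nat) (M A B : set 'rV[R]_N) (phi psi : 'rV[R]_N -> 'rV[R]_N).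
Hypotheses (mN : (m <= N)%N) (oA : open A) (oB : open B)
  (sphi : smooth_on A phi) (spsi : smooth_on B psi)
  (phiK : forall y, A y -> B (phi y) /\ psi (phi y) = y)
  (psiK : forall z, B z -> A (psi z) /\ phi (psi z) = z)
  (MA : forall y, A y -> M y <-> (forall i : 'I_N, (m <= i)%N -> phi y 0 i = 0)).

Lemma chart_dphiK z v : A z -> 'd psi (phi z) ('d phi z v) = v.
Proof.
move=> Az; have [Bz _] := phiK Az; apply: diff_local_inverse.
- exact: (@sphi z Az [::]).
- exact: (@spsi _ Bz [::]).
- by apply: filterS (open_nbhs_nbhs (conj oA Az)) => y /phiK[].
Qed.

Lemma chart_dpsiK z w : A z -> 'd phi z ('d psi (phi z) w) = w.
Proof.
move=> Az; have [Bz zE] := phiK Az; rewrite -[X in 'd phi X]zE.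
apply: diff_local_inverse.
- exact: (@spsi _ Bz [::]).
- by rewrite zE; exact: (@sphi z Az [::]).
- by apply: filterS (open_nbhs_nbhs (conj oB Bz)) => y /psiK[].
Qed.

(** In the chart a curve in M has zero coordinates from index m on, hence so has its velocity.
    Conversely, a straight line in the slice, carried back by psi, is a curve in M with the
    prescribed velocity. *)
Lemma tangent_space_chart z : A z -> M z ->
  tangent_space M z =
  [set v | (v <= (pid_mx m : 'M[R]_(m, N)) *m 'J psi (phi z))%MS].
Proof.
move=> Az Mz; have [Bz zE] := phiK Az.
have dphi : differentiable phi z by exact: (@sphi z Az [::]).
have dpsi : differentiable psi (phi z) by exact: (@spsi _ Bz [::]).
apply/seteqP; split=> [v [c [[C oC sc] cM c0 cv]]|v /= /submxP[u ->]].
  have C0 : C 0 by case: oC.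
  have dc : differentiable c 0 by exact: (@sc 0 C0 [::]).
  set w := 'd phi z v.
  have dE : 'd c 0 (1 : R) = v by rewrite -deriveE.
  have dphic : differentiable phi (c 0) by rewrite c0.
  have wE : w = 'D_1 (phi \o c) 0.
    rewrite deriveE; last exact: differentiable_comp.
    rewrite (diff_comp dc dphic).
    by rewrite /comp dE c0.
  have cA : \forall t \near (0 : R), A (c t).
    apply: (differentiable_continuous dc); rewrite c0.
    exact: open_nbhs_nbhs.
  have : (w <= (pid_mx m : 'M[R]_(m, N)))%MS.
    apply/pid_mx_sub => // i mi; rewrite wE derive_entry; last first.
      by apply: differentiable_comp => //; rewrite c0.
    rewrite (near_eq_derive (g := fun=> 0)) ?derive_cst//.
    by apply: filterS2 cM cA => t Mt At; apply: (MA At).1.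
  move=> /submxP[u uE].
  have vE : v = u *m (pid_mx m *m 'J psi (phi z)).
    by rewrite mulmxA -uE /jacobian mul_rV_lin1 /w chart_dphiK.
  by rewrite vE; exact: submxMl.
pose w := u *m (pid_mx m : 'M[R]_(m, N)); exists (fun t : R => psi (phi z + t *: w)); split.
- exact: smooth_near_line oB spsi Bz.
- have lc : (fun t : R => phi z + t *: w) @ 0 --> phi z + 0 *: w.
    by apply: cvgD; [exact: cvg_cst|exact: scalel_continuous].
  have : \forall t \near (0 : R), B (phi z + t *: w).
    by apply: lc; rewrite scale0r addr0; exact: open_nbhs_nbhs.
  apply: filterS => t Bt; have [At tE] := psiK Bt.
  apply/(MA At) => i mi; rewrite tE mxE ((MA Az).1 Mz i mi) add0r mxE.
  have /pid_mx_sub -> // : (w <= (pid_mx m : 'M[R]_(m, N)))%MS by rewrite submxMl.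
  by rewrite mulr0.
- by rewrite scale0r addr0.
- have Bz' : B (phi z + (0 : R) *: w) by rewrite scale0r addr0.
  have := @derive_val _ _ _ _ _ _ _ (is_derive_line 0 spsi Bz').
  by rewrite /= scale0r addr0 => ->; rewrite deriveEjacobian// mulmxA.
Qed.

Lemma chart_basis z : A z -> M z ->
  basis_rows ((pid_mx m : 'M[R]_(m, N)) *m 'J psi (phi z)) (tangent_space M z).
Proof.
move=> Az Mz; split; last exact: tangent_space_chart.
have Jf : row_free ('J psi (phi z)).
  apply/row_freeP; exists ('J phi z); apply/row_matrixP => i.
  rewrite !rowE mulmxA mulmx1.
  by rewrite !(mul_rV_lin1 ('d _ _)) chart_dpsiK.
by rewrite -row_leq_rank mxrankMfree// rank_pid_mx.
Qed.

(** The field V has constant coordinates in the chart. It handles limits inside a single stratum,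
    where Whitney's condition says nothing. *)
Lemma tangent_space_continuous y v : A y -> M y -> tangent_space M y v ->
  exists V : 'rV[R]_N -> 'rV[R]_N, [/\ V y = v, {for y, continuous V} &
    \forall z \near y, M z -> tangent_space M z (V z)].
Proof.
move=> Ay My; rewrite tangent_space_chart// => /= /submxP[u ->].
have [By yE] := phiK Ay.
exists (fun z => 'D_(u *m pid_mx m) psi (phi z)); split.
- by rewrite deriveEjacobian ?mulmxA//; exact: (@spsi _ By [::]).
- apply: (@continuous_comp _ _ _ phi ('D_(u *m pid_mx m) psi)).
    exact/differentiable_continuous/(@sphi y Ay [::]).
  exact/differentiable_continuous/(@spsi _ By [:: u *m pid_mx m]).
- apply: filterS (open_nbhs_nbhs (conj oA Ay)) => z Az Mz.
  have [Bz zE] := phiK Az.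
  rewrite tangent_space_chart//= deriveEjacobian; last exact: (@spsi _ Bz [::]).
  by rewrite -mulmxA submxMl.
Qed.

End Chart.

Lemma submanifold_basis N m (M : set 'rV[R]_N) z : submanifold m M -> M z ->
  exists b : 'M[R]_(m, N), basis_rows b (tangent_space M z).
Proof.
move=> [mN HM] Mz; have [A [B [phi [psi [[oA oB] [sA sB] H1 H2 H3]]]]] := HM z Mz.
have Az : A z by case: oA.
exists ((pid_mx m : 'M[R]_(m, N)) *m 'J psi (phi z)).
by apply: (chart_basis (A := A) (B := B)) => //; case: oA.
Qed.

Lemma submanifold_tangent_continuous N m (M : set 'rV[R]_N) y v :
  submanifold m M -> M y -> tangent_space M y v ->
  exists V : 'rV[R]_N -> 'rV[R]_N, [/\ V y = v, {for y, continuous V} &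
    \forall z \near y, M z -> tangent_space M z (V z)].
Proof.
move=> [mN HM] My; have [A [B [phi [psi [[oA oB] [sA sB] H1 H2 H3]]]]] := HM y My.
have Ay : A y by case: oA.
by apply: (tangent_space_continuous (m := m) (A := A) (B := B) (phi := phi)
  (psi := psi)) => //; case: oA.
Qed.

End Tangent.

(** * Openness of transversality *)

Section Whitney.
Context {R : realType} {N : nat}.
Implicit Types (M : set 'rV[R]_N).

Lemma basis_rows_line (u w : 'rV[R]_N) (a : R) :
  a != 0 -> u != 0 -> w = a *: u -> basis_rows w (line u).
Proof.
move=> a0 u0 ->; split.
  by rewrite -row_leq_rank rank_rV scaler_eq0 negb_or a0 u0.
apply/seteqP; split=> v /=.
  by move=> [s ->]; apply/sub_rVP; exists (s / a); rewrite scalerA divfK.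
by move=> /sub_rVP[s ->]; exists (s * a); rewrite scalerA.
Qed.

(* Condition (b) is applied to secants from the points xs to the points
   c (t n) of a curve in M with velocity v at y, where t n = sqrt |xs n - y|
   tends to 0 more slowly than |xs n - y|, so that the secants tend to v. *)
Lemma whitney_a m M' M y (xs : nat -> 'rV[R]_N) v (b0 : 'M[R]_(m, N)) :
  whitney_b m M' M -> M y -> (forall n, M' (xs n)) ->
  (forall n, ~ M (xs n)) -> xs @ \oo --> y ->
  grassmann_cvg m (fun n => tangent_space M' (xs n)) [set u | (u <= b0)%MS] ->
  tangent_space M y v -> (v <= b0)%MS.
Proof.
move=> wb My Mxs nMxs xsy gT [c [[C oC sc] cM c0 cv]].
(* The secants are to converge to the line through v, which requires v to be nonzero. *)
have [->|v0] := eqVneq v 0; first exact: sub0mx.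
pose t n : R := Num.sqrt `|xs n - y|.
have xy n : 0 < `|xs n - y|.
  rewrite normr_gt0 subr_eq0; apply/eqP => xE; apply: (nMxs n).
  by rewrite xE.
have t0 n : 0 < t n by rewrite sqrtr_gt0.
have tt n : t n * t n = `|xs n - y| by rewrite -expr2 sqr_sqrtr// ltW.
have tc : t @ \oo --> (0 : R).
  rewrite -[0]sqrtr0; apply: (@continuous_cvg _ _ _ _ _ (fun n => `|xs n - y|) Num.sqrt 0).
    exact: sqrt_continuous.
  have -> : (0 : R) = `|y - y| by rewrite subrr normr0.
  by apply: cvg_norm; apply: cvgB => //; exact: cvg_cst.
have tc' : t @ \oo --> (0 : R)^'.
  move=> S [e /= e0 HS].
  have /cvgrPdist_lt/(_ e e0) := tc; apply: filterS => n te.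
  by apply: HS => //; rewrite gt_eqF.
have C0 : C 0 by case: oC.
have dc : differentiable c 0 by exact: (@sc 0 C0 [::]).
(* The curve lies in M only for small parameters, while condition (b) wants every term in M; y is a
   default value for finitely many n. *)
pose ys n := if pselect (M (c (t n))) then c (t n) else y.
have Mys n : M (ys n) by rewrite /ys; case: pselect.
have ysE : \forall n \near \oo, ys n = c (t n).
  have H : \forall n \near \oo, M (c (t n)) by exact: (tc _ cM).
  by apply: filterS H => n Mn; rewrite /ys; case: pselect.
have cc : (c \o t) @ \oo --> y.
  have ccont : c @ (0 : R) --> c 0 := differentiable_continuous dc.
  by rewrite -c0; exact: (cvg_comp _ _ tc ccont).
have ysy : ys @ \oo --> y.
  apply: cvg_trans cc; apply: near_eq_cvg.
  by apply: filterS ysE => n /= ->.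
have xys n : xs n != ys n.
  by apply/eqP => xE; apply: (nMxs n); rewrite xE.
(* The sign reverses the secant, so that the limit is v. For large n it is the difference quotient
   of c plus a term of norm |xs n - y| / t n = t n, which tends to 0. *)
pose b n : 'rV[R]_N := (- (t n)^-1) *: (xs n - ys n).
have bv : b @ \oo --> v.
  have dcv : (fun h : R => h^-1 *: ((c \o shift 0) (h *: (1 : R)) - c 0)) @ 0^' --> v.
    by rewrite -cv; exact: (diff_derivable dc).
  have H1 : (fun n => (t n)^-1 *: (c (t n) - y)) @ \oo --> v.
    have -> : (fun n => (t n)^-1 *: (c (t n) - y)) =
        (fun h : R => h^-1 *: ((c \o shift 0) (h *: (1 : R)) - c 0)) \o t.
      by apply/funext => n; rewrite /= addr0 -[t n *: 1]/(t n * 1) mulr1 c0.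
    exact: (cvg_comp _ _ tc' dcv).
  have H2 : (fun n => (t n)^-1 *: (y - xs n)) @ \oo --> (0 : 'rV[R]_N).
    apply/cvgr0Pnorm_lt => e e0; have /cvgr0Pnorm_lt/(_ e e0) := tc.
    apply: filterS => n; rewrite (gtr0_norm (t0 n)) normrZ distrC -tt.
    by rewrite gtr0_norm ?invr_gt0// mulKf// gt_eqF.
  have H3 : (fun n => (t n)^-1 *: (c (t n) - y) + (t n)^-1 *: (y - xs n)) @ \oo --> v.
    by rewrite -[v]addr0; exact: cvgD.
  apply: cvg_trans H3; apply: near_eq_cvg.
  apply: filterS ysE => n nE; rewrite /b nE -scalerDr scaleNr -scalerN.
  by congr (_ *: _); rewrite opprB addrA subrK.
have := wb y xs ys (line v) [set u | (u <= b0)%MS] My Mxs Mys xsy ysy xys _ gT.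
move=> /(_ _ v); apply; last by exists 1; rewrite scale1r.
exists b, v; split => // [n|].
  apply: (@basis_rows_line _ _ (- (t n)^-1)) => //;
    by rewrite ?oppr_eq0 ?invr_eq0 ?gt_eqF// subr_eq0.
by apply: (@basis_rows_line _ _ 1) => //; rewrite ?scale1r ?oner_neq0.
Qed.

Section Transversality.
Variables (n : nat) (phi : 'rV[R]_n -> 'rV[R]_N) (X : set 'rV[R]_N)
  (U : set (set 'rV[R]_N)) (x0 : 'rV[R]_n).
Hypotheses (wU : whitney_stratification X U) (Xx0 : X (phi x0))
  (cphi : {for x0, continuous phi})
  (cdphi : forall v, {for x0, continuous (fun x => 'd phi x v)})
  (tr0 : forall M, U M -> transverse_at phi M x0).

Lemma non_transverse_covector m M x : submanifold m M ->
  ~ transverse_at phi M x ->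
  M (phi x) /\ exists (b : 'M[R]_(m, N)) (xi : 'rV[R]_N),
    [/\ basis_rows b (tangent_space M (phi x)), b *m b^T = 1%:M,
      xi *m xi^T = 1%:M, forall v, 'd phi x v *m xi^T = 0 & b *m xi^T = 0].
Proof.
move=> sM nt.
have Mx : M (phi x) by apply: contrapT => nM; apply: nt.
split=> //; have [b1 [b1f b1T]] := submanifold_basis sM Mx.
have [b bb1 bo] := orthonormal_basis b1f.
have bT : tangent_space M (phi x) = [set v | (v <= b)%MS].
  by rewrite b1T; apply/seteqP; split=> v /=; rewrite bb1.
have [|xi [xio dxi bxi]] := @covector _ _ _ _ ('d phi x) b.
  move=> H; apply: nt => _ w; have [v [t [tb wE]]] := H w.
  by exists v, t; rewrite bT.
by exists b, xi; split => //; split => //; exact: orthonormal_row_free.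
Qed.

(** The contradiction comes from transversality at x0 to the stratum M0 through [phi x0], which may
    differ from M: a limit of covectors at bad points annihilates the image of the differential at
    x0 and the tangent space of M0. *)
Lemma transverse_near_stratum M : U M ->
  \forall x \near x0, transverse_at phi M x.
Proof.
move=> UM; have [[pU mU lfU] wbU] := wU; have [m sM] := mU M UM.
apply: contrapT => nt.
have /(_ _)/cid-/all_sig[xs xsP] : forall i : nat, exists x,
    ball x0 i.+1%:R^-1 x /\ ~ transverse_at phi M x.
  move=> i; apply: contrapT => H; apply: nt.
  apply/nbhs_ballP; exists i.+1%:R^-1 => /=; first by rewrite invr_gt0.
  by move=> x bx; apply: contrapT => ntx; apply: H; exists x.
have xsx0 : xs @ \oo --> x0.
  apply/cvgrPdist_lt => e e0; have [i _ iP] := near_infty_natSinv_lt (PosNum e0).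
  exists i => // j /= ij; have [+ _] := xsP j; rewrite -ball_normE/= => /lt_trans; apply.
  exact: iP.
have Mxs i : M (phi (xs i)) by have [] := non_transverse_covector sM (xsP i).2.
have /(_ _)/cid-/all_sig[b bP] := fun i => (non_transverse_covector sM (xsP i).2).2.
have {bP}/(_ _)/cid-/all_sig[xi bP] := bP.
(* Frame and covector are stacked so that a single subsequence makes both converge. *)
have [|f fi [l cl]] := @mx_bolzano R _ _ (fun i => col_mx (b i) (xi i)).
  move=> t i j; rewrite !mxE; have [_ bo xo _ _] := bP t.
  by case: split_ordP => s _; exact: orthonormal_entry.
set b0 := usubmx l; set xi0 := dsubmx l.
have cb : (b \o f) @ \oo --> b0.
  apply/cvg_mxP => i j; have /cvg_mxP/(_ (lshift _ i) j) := cl.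
  by rewrite /b0 mxE; under eq_fun do rewrite /= col_mxEu.
have cxi : (xi \o f) @ \oo --> xi0.
  apply/cvg_mxP => i j; have /cvg_mxP/(_ (rshift _ i) j) := cl.
  by rewrite /xi0 mxE; under eq_fun do rewrite /= col_mxEd.
have cxs : (xs \o f) @ \oo --> x0 by exact: cvg_subseq.
have cpx : (phi \o (xs \o f)) @ \oo --> phi x0 by exact: (cvg_comp _ _ cxs cphi).
have b0o : b0 *m b0^T = 1%:M.
  by apply: cvg_near_cst_eq (cvg_mulmx cb (cvg_trmx cb)); apply: nearW => i /=; have [] := bP (f i).
have xi0o : xi0 *m xi0^T = 1%:M.
  by apply: cvg_near_cst_eq (cvg_mulmx cxi (cvg_trmx cxi)); apply: nearW => i /=; have [] := bP (f i).
have b0xi0 : b0 *m xi0^T = 0.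
  by apply: cvg_near_cst_eq (cvg_mulmx cb (cvg_trmx cxi)); apply: nearW => i /=; have [] := bP (f i).
have dxi0 v : 'd phi x0 v *m xi0^T = 0.
  have cd : (fun i => 'd phi ((xs \o f) i) v) @ \oo --> 'd phi x0 v.
    have cdv : (fun x => 'd phi x v) @ x0 --> 'd phi x0 v := @cdphi v.
    exact: (cvg_comp _ _ cxs cdv).
  apply: cvg_near_cst_eq (cvg_mulmx cd (cvg_trmx cxi)); apply: nearW => i /=.
  by have [_ _ _ + _] := bP (f i); exact.
have [M0 UM0 M0x0] : exists2 M0, U M0 & M0 (phi x0).
  by have [cU _ _] := pU; move: Xx0; rewrite -cU => -[M0 UM0 ?]; exists M0.
have TM0 v : tangent_space M0 (phi x0) v -> v *m xi0^T = 0.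
  have [MM0|MM0] := pselect (M = M0).
    rewrite -MM0 in M0x0 * => Tv.
    have [V [<- cV VT]] := submanifold_tangent_continuous sM M0x0 Tv.
    have cVx : (V \o (phi \o (xs \o f))) @ \oo --> V (phi x0) by exact: (cvg_comp _ _ cpx cV).
    apply: cvg_near_cst_eq (cvg_mulmx cVx (cvg_trmx cxi)).
    have VTf : \forall i \near \oo, M (phi (xs (f i))) ->
        tangent_space M (phi (xs (f i))) (V (phi (xs (f i)))) by exact: (cpx _ VT).
    apply: filterS VTf => i /= /(_ (Mxs _)).
    have [[_ ->] _ _ _ bxi] := bP (f i) => /= /submxP[u ->].
    by rewrite -mulmxA bxi mulmx0.
  (* For distinct strata, disjointness keeps the sequence off M0, and condition (a) places the
     tangent space of M0 in the limit plane spanned by [b0]. *)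
  move=> Tv.
  have nM0 i : ~ M0 (phi (xs (f i))).
    move=> M0i; apply: MM0; have [_ tU _] := pU.
    by apply: (tU M M0 UM UM0); exists (phi (xs (f i))).
  have := whitney_a (wbU m M M0 UM UM0 MM0 sM) M0x0 (fun i => Mxs (f i)) nM0 cpx _ Tv.
  move=> /(_ b0)/(_ _)/submxP[|u ->]; last by rewrite -mulmxA b0xi0 mulmx0.
  exists (b \o f), b0; split => // [i|]; first by have [] := bP (f i).
  by split => //; exact: orthonormal_row_free.
(* Transversality decomposes [xi0] itself into two vectors orthogonal to [xi0], although it has norm
   1. *)
have [v [t [Tt xiE]]] := tr0 UM0 M0x0 xi0.
have : xi0 *m xi0^T = 0 by rewrite {1}xiE mulmxDl dxi0 TM0// addr0.
by rewrite xi0o => /matrixP/(_ 0 0)/eqP; rewrite !mxE eqxx oner_eq0.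
Qed.

(** By local finiteness only finitely many strata meet a neighbourhood of [phi x0], so finitely many
    neighbourhoods are intersected; transversality to the other strata is vacuous there. *)
Lemma transverse_near :
  exists2 A, nbhs x0 A & transverse_to_strat phi U A.
Proof.
have [[_ _ /(_ _ Xx0)[B nB fB]] _] := wU.
exists [set x | B (phi x) /\ forall M, U M /\ M `&` B !=set0 -> transverse_at phi M x].
  apply: filterI; first exact: cphi.
  have [s sE] := (finite_seqP _).1 fB.
  have : \forall x \near x0, forall M, M \in s -> transverse_at phi M x.
    have sU M : M \in s -> U M by move=> Ms; have [] : [set` s] M by []; rewrite -sE => -[].
    elim: s {sE} sU => [|M s IH] sU; first by apply: (@filterE _ (nbhs x0)) => x M; rewrite in_nil.
    apply: filterS2 (transverse_near_stratum (sU M (mem_head _ _))) (IH _).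
      by move=> x tM ts M1; rewrite inE => /predU1P[->//|/ts].
    by move=> M1 M1s; apply: sU; rewrite inE M1s orbT.
  by apply: filterS => x H M UM; apply: H; have : [set M | U M /\ M `&` B !=set0] M by []; rewrite sE.
move=> M UM x [Bx H] Mx.
have tM : transverse_at phi M x by apply: H; split => //; exists (phi x).
exact: tM.
Qed.
End Transversality.
End Whitney.

(** * Comparison of the two sections *)

Section Section1Jet.
Context {R : realType} {d l k : nat}.
Variable (p : l.-tuple (mpoly d R)).
Local Notation P := (orbit_map p).

Lemma orbit_map_polymap : polymap P.
Proof. by move=> j; under eq_fun do rewrite mxE; exact: polyfun_peval. Qed.

(** The three cases are the coordinates x, h and A. The case is fixed before H is quantified, so
    that the sections of H and H' can be compared coordinate by coordinate. *)
Lemma H1_section_entry (i : 'I_(d + (k + k * l))) :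
  [\/ exists j, forall H, smooth_on setT H ->
        (fun x => H1_section p H x 0 i) = (fun x => x 0 j),
      exists a : 'I_k, forall H, smooth_on setT H ->
        (fun x => H1_section p H x 0 i) = (fun x => H (P x) 0 a) |
      exists (a : 'I_k) (b : 'I_l), forall H, smooth_on setT H ->
        (fun x => H1_section p H x 0 i) =
        (fun x => 'D_(delta_mx 0 b) (fun y => H y 0 a) (P x))].
Proof.
case: (split_ordP i) => [j ->|i' ->].
  apply: Or31; exists j => H sH; apply/funext => x.
  by rewrite /H1_section /jcoord row_mxEl.
case: (split_ordP i') => [a ->|i'' ->].
  apply: Or32; exists a => H sH; apply/funext => x.
  by rewrite /H1_section /jcoord row_mxEr row_mxEl.
apply: Or33; case/mxvec_indexP: i'' => a b; exists a, b => H sH; apply/funext => x.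
have dH : differentiable H (P x) by exact: (sH (P x) I [::]).
rewrite /H1_section /jcoord !row_mxEr mxvecE -derive_entry// deriveE//.
by rewrite mxE mxE.
Qed.

Lemma diff_comp_entry (g : 'rV[R]_l -> R) (v : 'rV[R]_d) :
  differentiable g (P 0) -> 'D_v (g \o P) 0 = 'D_('d P 0 v) g (P 0).
Proof.
move=> dg; have dP : differentiable P 0 by apply: polymap_differentiable; exact: orbit_map_polymap.
rewrite deriveE; last exact: differentiable_comp.
by rewrite diff_comp// deriveE.
Qed.

Lemma H1_section_differentiable (H : 'rV[R]_l -> 'rV[R]_k) x : smooth_on setT H ->
  differentiable (H1_section p H) x.
Proof.
move=> sH; apply: differentiable_rowP => i.
have dP : differentiable P x by apply: polymap_differentiable; exact: orbit_map_polymap.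
case: (H1_section_entry i) => [[j /(_ H sH)->]|[a /(_ H sH)->]|[a [b /(_ H sH)->]]].
- exact: differentiable_coord.
- apply: (@differentiable_comp _ _ _ _ P (fun y => H y 0 a)) => //.
  exact: (smooth_on_entry a sH I [::]).
- apply: (@differentiable_comp _ _ _ _ P ('D_(delta_mx 0 b) (fun y => H y 0 a))) => //.
  exact: (smooth_on_entry a sH I [:: delta_mx 0 b]).
Qed.

Lemma H1_section_diff_entry (H : 'rV[R]_l -> 'rV[R]_k) (v : 'rV[R]_d) i :
  smooth_on setT H ->
  ('d (H1_section p H) 0 v) 0 i = 'D_v (fun x => H1_section p H x 0 i) 0.
Proof.
move=> /(H1_section_differentiable 0) dS.
by rewrite -(deriveE v dS); exact: (derive_entry v i dS).
Qed.

Lemma H1_section_polymap (H : 'rV[R]_l -> 'rV[R]_k) : polymap H -> polymap (H1_section p H).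
Proof.
move=> pH i; have sH := polymap_smooth pH.
case: (H1_section_entry i) => [[j /(_ H sH)->]|[a /(_ H sH)->]|[a [b /(_ H sH)->]]].
- exact: polyfun_coord.
- exact: (polyfun_comp (pH a) orbit_map_polymap).
- exact: (polyfun_comp (polyfun_derive _ (pH a)) orbit_map_polymap).
Qed.

Section Comparison.
Variables (H H' : 'rV[R]_l -> 'rV[R]_k) (C : 'I_k -> R).
Hypotheses (sH : smooth_on setT H) (sH' : smooth_on setT H')
  (C0 : forall a, 0 <= C a)
  (HH' : forall a, \forall z \near (0 : 'rV[R]_l),
     `|H (P 0 + z) 0 a - H' (P 0 + z) 0 a| <= C a * `|z| ^+ 3).

Let W a : 'rV[R]_l -> R := fun y => H y 0 a - H' y 0 a.

Let iterDW a vs : iterD vs (W a) =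
  (fun y => iterD vs (fun y => H y 0 a) y - iterD vs (fun y => H' y 0 a) y).
Proof.
elim: vs => [//|v vs IH] /=; apply/funext => y; rewrite IH.
rewrite [LHS]deriveB//; apply: diff_derivable.
  exact: (smooth_on_entry a sH).
exact: (smooth_on_entry a sH').
Qed.

Let smooth_W a : smooth_on setT (W a).
Proof.
move=> y _ vs; rewrite iterDW; apply: differentiableB.
  exact: (smooth_on_entry a sH).
exact: (smooth_on_entry a sH').
Qed.

Let jet2 a :
  [/\ H (P 0) 0 a = H' (P 0) 0 a,
      forall b, 'D_b (fun y => H y 0 a) (P 0) = 'D_b (fun y => H' y 0 a) (P 0) &
      forall b c, 'D_c ('D_b (fun y => H y 0 a)) (P 0) =
        'D_c ('D_b (fun y => H' y 0 a)) (P 0)].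
Proof.
split=> [|b|b c]; apply/eqP; rewrite -subr_eq0; apply/eqP.
- exact: (@order3_eq0 _ _ (W a) (P 0) _ (HH' a)).
- rewrite -(@order3_derive_eq0 _ _ (W a) (P 0) _ (@smooth_W a) (C0 a) (HH' a) b).
  by rewrite -[RHS]/(iterD [:: b] (W a) (P 0)) iterDW.
- rewrite -(@order3_derive2_eq0 _ _ (W a) (P 0) _ (@smooth_W a) (C0 a) (HH' a) c b).
  by rewrite -[RHS]/(iterD [:: c; b] (W a) (P 0)) iterDW.
Qed.

Lemma H1_section_eq0 : H1_section p H 0 = H1_section p H' 0.
Proof.
apply/rowP => i.
have S0 (K : 'rV[R]_l -> 'rV[R]_k) g :
    (fun x => H1_section p K x 0 i) = g -> H1_section p K 0 0 i = g 0.
  by move=> <-.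
case: (H1_section_entry i) => [[j E]|[a E]|[a [b E]]];
  apply: (etrans (S0 _ _ (E _ sH))); apply: esym;
  apply: (etrans (S0 _ _ (E _ sH'))).
- by [].
- by have [-> _ _] := jet2 a.
- by have [_ -> _] := jet2 a.
Qed.

(** By the chain rule through P, the coordinates h and A contribute first and second derivatives at
    P(0), on which H and H' agree. *)
Lemma H1_section_diff_eq0 v :
  'd (H1_section p H) 0 v = 'd (H1_section p H') 0 v.
Proof.
apply/rowP => i; apply: (etrans (H1_section_diff_entry v i sH)); apply: esym.
apply: (etrans (H1_section_diff_entry v i sH')).
have S0 (K : 'rV[R]_l -> 'rV[R]_k) g : (fun x => H1_section p K x 0 i) = g ->
    'D_v (fun x => H1_section p K x 0 i) 0 = 'D_v g 0.
  by move=> ->.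
case: (H1_section_entry i) => [[j E]|[a E]|[a [b E]]];
  apply: (etrans (S0 _ _ (E _ sH'))); apply: esym;
  apply: (etrans (S0 _ _ (E _ sH))).
- by [].
- have dg (K : 'rV[R]_l -> 'rV[R]_k) : smooth_on setT K -> differentiable (fun y => K y 0 a) (P 0).
    by move=> sK; exact: (smooth_on_entry a sK I [::]).
  rewrite (diff_comp_entry v (dg _ sH)) (diff_comp_entry v (dg _ sH')).
  by have [_ -> _] := jet2 a.
- have dg (K : 'rV[R]_l -> 'rV[R]_k) : smooth_on setT K ->
      differentiable ('D_(delta_mx 0 b) (fun y => K y 0 a)) (P 0).
    by move=> sK; exact: (smooth_on_entry a sK I [:: delta_mx 0 b]).
  rewrite (diff_comp_entry v (dg _ sH)) (diff_comp_entry v (dg _ sH')).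
  by have [_ _ ->] := jet2 a.
Qed.

Lemma H1_section_transverse_at M :
  transverse_at (H1_section p H) M 0 -> transverse_at (H1_section p H') M 0.
Proof.
rewrite /transverse_at H1_section_eq0 => tM Mx w; have [v [t [Tt ->]]] := tM Mx w.
exists v, t; split; first exact: Tt.
exact: (congr1 (fun u => u + t) (H1_section_diff_eq0 v)).
Qed.

End Comparison.

(** At x = 0 one of the two columns is zero, so the rank is at most 1 whatever the gradient. This
    puts the base point in the stratified set, as openness of transversality requires. *)
Lemma H1_section_u_preim_Z (F : k.-tuple (mpoly d R)) (H : 'rV[R]_l -> 'rV[R]_k) :
  u_preim_Z p F (H1_section p H 0).
Proof.
exists 0, (H (P 0)), ('J H (P 0))^T; split=> //.
rewrite /Zset /= trmx0 -mxrank_tr tr_row_mx trmx0 -addsmxE.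
by rewrite (leq_trans (mxrank_adds_leqif _ _))// mxrank0 add0n rank_leq_row.
Qed.

End Section1Jet.

(** * Finite determinacy of the tangency germ *)

Unset Implicit Arguments.

Theorem proposition5p5 (R : realType) (gT : finGroupType) (d : nat)
  (to : {action gT &-> 'I_d})
  (l k : nat)
  (p : l.-tuple (mpoly d R)) (F : k.-tuple (mpoly d R))
  (hp : minimal_invariant_generators to p)
  (hF : minimal_inv0_generators to F)
  (U : set (set 'rV[R]_(d + (k + k * l))))
  (hU : canonical_stratification (u_preim_Z p F) U)
  (f : 'rV[R]_d -> R)
  (hf : smooth_invariant_germ to f)
  (hf0 : f 0 = 0)
  (hdf0 : forall v : 'rV[R]_d, 'd f 0 v = 0)
  (hreg : mho_regular p F U f) :
  exists r : nat, mho_regular p F U (taylor0 r f).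
Proof.
have [H [sH fE [A nA trA]]] := hreg.
have [hp1 _ _] := hp; have [hF1 _ _] := hF; have [sf _] := hf; have [wU _] := hU.
have [r [H' [C [pH' C0 tE HH']]]] :=
  taylor0_decomposition (fun j => (hp1 j).2) (fun i => (hF1 i).2) sf sH fE.
have sH' := polymap_smooth pH'.
exists r, H'; split => //; first by apply: filterE => x; exact: tE.
apply: (transverse_near wU) => [|||M UM].
- exact: H1_section_u_preim_Z.
- by apply: differentiable_continuous; exact: H1_section_differentiable.
- by move=> v; apply: polymap_diff_continuous; exact: H1_section_polymap.
- apply: (H1_section_transverse_at sH sH' C0 HH').
  by apply: trA => //; exact: nbhs_singleton.
Qed.
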